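(* Let $F$ be a free group of finite rank with a fixed basis $A$. The closest element problem in $F$ is solvable in polynomial time. That is, there is an algorithm which, given words $h_1,\dots,h_n$ and $g$ in $A\cup A^{-1}$, finds (as a word in $A\cup A^{-1}$) an element $h$ of the subgroup $H=\langle h_1,\dots,h_n\rangle\le F$ such that $d_A(g,h)=\min_{h'\in H} d_A(g,h')$, in time polynomial in the total length of the input words.
   Context: For a group $G$ with finite generating set $A$, $|g|$ is the length of a shortest word in $A\cup A^{-1}$ representing $g\in G$, and $d_A(g,h)=|g^{-1}h|$ is the word metric. Elements are given by words in $A\cup A^{-1}$; finitely generated subgroups are given by finite lists of generators written as such words. Closest element problem (element-subgroup distance problem) in $G$: given a finitely generated subgroup $H\le G$ and $g\in G$, find $h\in H$ closest to $g$ in the word metric $d_A$. The group $G$ and the generating set $A$ are fixed (not part of the input). *)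

(* Defs.v *)
From HB Require Import structures.
From mathcomp Require Import all_boot all_algebra.

Set Implicit Arguments.
Unset Strict Implicit.
Unset Printing Implicit Defensive.

(* Polynomial time is formalized with the WHILE language of N. D. Jones'      *)
(* textbook on computability and complexity: structured programs over         *)
(* finitely many variables that hold binary trees.  Every evaluation of a     *)
(* subexpression is charged the number of nodes of its value, i.e. values are *)
(* costed as if they were copied node by node and never shared.  Hence no     *)
(* value can outgrow the time spent, and a multitape Turing machine simulates *)
(* programs, and is simulated by them, with polynomial overhead.              *)

Inductive tree : Type :=
| Nil
| Cons of tree & tree.

Fixpoint tree_size (t : tree) : nat :=
  if t is Cons l r then (tree_size l + tree_size r).+1 else 1.

Fixpoint tree_eqb (t u : tree) : bool :=
  match t, u with
  | Nil, Nil => true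
  | Cons l r, Cons l' r' => tree_eqb l l' && tree_eqb r r'
  | _, _ => false
  end.

Definition is_nil (t : tree) : bool := if t is Nil then true else false.

Inductive expr : Type :=
| EVar of nat
| ENil
| ECons of expr & expr
| EHead of expr
| ETail of expr
| EEq of expr & expr.

Inductive cmd : Type :=
| Skip
| Assign of nat & expr
| Seq of cmd & cmd
| If of expr & cmd & cmd
| While of expr & cmd.

Definition store := nat -> tree.

Definition update (s : store) (x : nat) (t : tree) : store :=
  fun y => if y == x then t else s y.

Fixpoint eval (s : store) (e : expr) : tree :=
  match e with
  | EVar x => s x
  | ENil => Nil
  | ECons e1 e2 => Cons (eval s e1) (eval s e2)
  | EHead e1 => if eval s e1 is Cons l _ then l else Nil
  | ETail e1 => if eval s e1 is Cons _ r then r else Nil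
  | EEq e1 e2 => if tree_eqb (eval s e1) (eval s e2) then Cons Nil Nil else Nil
  end.

Fixpoint eval_cost (s : store) (e : expr) : nat :=
  tree_size (eval s e) +
  match e with
  | EVar _ | ENil => 0
  | EHead e1 | ETail e1 => eval_cost s e1
  | ECons e1 e2 | EEq e1 e2 => eval_cost s e1 + eval_cost s e2
  end.

(* [exec c s n s'] : started in store [s], the program [c] halts in store     *)
(* [s'] at total cost [n].                                                    *)
Inductive exec : cmd -> store -> nat -> store -> Prop :=
| exec_skip s : exec Skip s 1 s
| exec_assign s x e :
    exec (Assign x e) s (eval_cost s e).+1 (update s x (eval s e))
| exec_seq c1 c2 s s1 s2 n1 n2 :
    exec c1 s n1 s1 -> exec c2 s1 n2 s2 -> exec (Seq c1 c2) s (n1 + n2) s2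
| exec_if s e c1 c2 s' n :
    exec (if is_nil (eval s e) then c2 else c1) s n s' ->
    exec (If e c1 c2) s (eval_cost s e + n) s'
| exec_while_done s e c :
    is_nil (eval s e) -> exec (While e c) s (eval_cost s e) s
| exec_while_step s e c s1 s2 n1 n2 :
    ~~ is_nil (eval s e) -> exec c s n1 s1 -> exec (While e c) s1 n2 s2 ->
    exec (While e c) s (eval_cost s e + n1 + n2) s2.

Lemma exec_det c s n s' m s'' :
  exec c s n s' -> exec c s m s'' -> n = m /\ s' = s''.
Proof.
move=> H; elim: H m s'' => {c s n s'}.
- by move=> s m s'' H; inversion H.
- by move=> s x e m s'' H; inversion H.
- move=> c1 c2 s s1 s2 n1 n2 _ IH1 _ IH2 m s'' H.
  inversion H as [| |? ? ? ? ? ? ? E1 E2| | |]; subst.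
  case: (IH1 _ _ E1) => ? ?; subst.
  by case: (IH2 _ _ E2) => ? ?; subst.
- move=> s e c1 c2 s' n _ IH m s'' H.
  inversion H as [| | |? ? ? ? ? ? E1| |]; subst.
  by case: (IH _ _ E1) => ? ?; subst.
- move=> s e c Hn m s'' H.
  inversion H as [| | | | |? ? ? ? ? ? ? Hn']; subst => //.
  by rewrite Hn in Hn'.
- move=> s e c s1 s2 n1 n2 Hn _ IH1 _ IH2 m s'' H.
  inversion H as [| | | |? ? ? Hn'|? ? ? ? ? ? ? Hn' E1 E2]; subst.
    by rewrite Hn' in Hn.
  case: (IH1 _ _ E1) => ? ?; subst.
  by case: (IH2 _ _ E2) => ? ?; subst.
Qed.

(* The input is passed in variable 0, where the output is also left.          *)
Definition init (t : tree) : store := fun x => if x == 0 then t else Nil.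

(* Finding, given [i], some [o] with [spec i o] is possible in time           *)
(* polynomial in [isize i], for the given encodings of inputs and outputs.    *)
Definition poly_time_solvable (I O : Type) (encI : I -> tree) (encO : O -> tree)
    (isize : I -> nat) (spec : I -> O -> Prop) : Prop :=
  exists (c : cmd) (p : {poly nat}), forall i : I,
    exists (o : O) (n : nat) (s : store),
      [/\ exec c (init (encI i)) n s, n <= (p.[isize i])%R,
          s 0 = encO o & spec i o].

Fixpoint nat_tree (n : nat) : tree :=
  if n is n'.+1 then Cons Nil (nat_tree n') else Nil.

Definition list_tree (T : Type) (enc : T -> tree) (l : seq T) : tree :=
  foldr (fun x t => Cons (enc x) t) Nil l.

Section Words.

Variable A : finType.

(* (a, false) stands for a and (a, true) for a^-1.                            *)
Definition letter : Type := (A * bool)%type.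
Definition word : Type := seq letter.

Definition letter_tree (x : letter) : tree :=
  Cons (nat_tree (enum_rank x.1)) (nat_tree x.2).

Definition word_tree (w : word) : tree := list_tree letter_tree w.

Definition instance_tree (i : seq word * word) : tree :=
  Cons (list_tree word_tree i.1) (word_tree i.2).

(* Total length of the input words, each generator counting for one more than *)
(* its length: the list may contain arbitrarily many empty words, and these   *)
(* have to be read too.                                                       *)
Definition instance_size (i : seq word * word) : nat :=
  (\sum_(h <- i.1) (size h).+1) + size i.2.

End Words.

Section Groups.

Local Open Scope group_scope.

Variable F : groupType.

Definition is_morphism (G : groupType) (f : F -> G) : Prop :=
  {morph f : x y / x * y >-> x * y}.

(* F is free with basis iota, by the universal property; uniqueness of the    *)
(* extension is up to extensional equality.  This entails that iota is        *)
(* injective.                                                                 *)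
Definition free_basis (A : finType) (iota : A -> F) : Prop :=
  forall (G : groupType) (f : A -> G),
    (exists2 phi : F -> G, is_morphism phi & forall a, phi (iota a) = f a) /\
    (forall phi psi : F -> G, is_morphism phi -> is_morphism psi ->
       (forall a, phi (iota a) = psi (iota a)) -> phi =1 psi).

Inductive generated (S : F -> Prop) : F -> Prop :=
| gen_one : generated S 1
| gen_mem x : S x -> generated S x
| gen_mul x y : generated S x -> generated S y -> generated S (x * y)
| gen_inv x : generated S x -> generated S x^-1.

Variables (A : finType) (iota : A -> F).

Definition letter_val (x : letter A) : F :=
  if x.2 then (iota x.1)^-1 else iota x.1.

Definition word_val (w : word A) : F := \prod_(x <- w) letter_val x.

Definition subgroup_of_words (hs : seq (word A)) : F -> Prop :=
  generated (fun x => exists2 h, h \in hs & x = word_val h).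

(* |x| = n; a functional relation, which is total when A generates F.         *)
Definition word_length (x : F) (n : nat) : Prop :=
  (exists2 w : word A, word_val w = x & size w = n) /\
  (forall w : word A, word_val w = x -> n <= size w).

(* d_A(x, y) = n *)
Definition word_dist (x y : F) (n : nat) : Prop := word_length (x^-1 * y) n.

Definition closest_in (H : F -> Prop) (g h : F) : Prop :=
  H h /\
  exists2 n, word_dist g h n &
    forall h' n', H h' -> word_dist g h' n' -> n <= n'.

Definition closest_element_spec (i : seq (word A) * word A) (h : word A) : Prop :=
  closest_in (subgroup_of_words i.1) (word_val i.2) (word_val h).

End Groups.

(* Main.v *)
From HB Require Import structures.
From mathcomp Require Import all_boot all_algebra zify.
Require Import Defs.

(* Let H be generated by h_1, ..., h_n.  Reading each h_i as a loop at a base *)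
(* vertex and g as a path from it to a vertex t, and identifying edges with   *)
(* the same source and label until the graph is deterministic (Stallings      *)
(* folding), one gets a finite part of the Schreier graph of H, in which t    *)
(* stands for the coset H g.  The labels of the walks from t to the base lie  *)
(* in g^-1 H, and all reduced words of g^-1 H are such labels, since in a     *)
(* deterministic graph closed under inverses a walk can be freely reduced.    *)
(* Hence a shortest such walk w gives a closest element g w of H.  Shortest   *)
(* walks are found by keeping, for k = 0, 1, ..., |g|, one walk of length k   *)
(* from each vertex that has one.                                             *)

Set Implicit Arguments.
Unset Strict Implicit.
Unset Printing Implicit Defensive.

(** * Polynomial bounds and polynomial-time computability *)

(** Soundness: every vertex name is a word and so names a coset of [H], and every edge respects
    cosets ([coset_edges]). Hence a walk from the target [t] to the base spells some [w] with [g w]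
    in [H] ([walk_coset]). Completeness: every element of [H] is the value of a loop at the base
    ([loop_label]), and preceding such loops by the inverse of the path [g] gives every element of
    [g^-1 H] as the value of a walk from [t] to the base. Folding preserves both properties
    ([fold_invariant_step]) and produces determinism, after which a cancelling pair of letters can
    be deleted from a walk without moving its ends ([walk_nf]). In a free group words of equal value
    have the same normal form ([word_val_inj_nf]), and a normal form is no longer than the word. So
    the least length of a walk from [t] to the base is the distance from [g] to [H]. The inverse of
    [g] is itself such a walk, which is why [|g|] rounds of search suffice ([search_shortest]).

    The time is polynomial for two reasons. The number of rounds is: a potential shows that folding
    ends within the square of the number of edges ([fold_graph_done]). And no intermediate value
    explodes: folding only copies existing vertex names ([fold_step_le]), and the search keeps at
    most one word per edge ([extend_le]). These size bounds feed the closure rules of [computable],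
    chiefly [computable_foldl], by which a polynomial-time body gives a polynomial-time loop as long
    as all states reached have polynomial size. *)

Definition poly_bound (X : Type) (m f : X -> nat) : Prop :=
  exists p : {poly nat}, forall x, f x <= (p.[m x])%R.

Lemma horner_nat_le (p : {poly nat}) (a b : nat) :
  a <= b -> ((p.[a])%R <= (p.[b])%R)%N.
Proof.
move=> le_ab; elim/poly_ind: p => [|p c IH]; first by rewrite !horner0.
by rewrite !hornerMXaddC leq_add // leq_mul.
Qed.

Section PolyBound.

Variables (X : Type) (m : X -> nat).

Lemma poly_bound_le (f g : X -> nat) :
  (forall x, f x <= g x) -> poly_bound m g -> poly_bound m f.
Proof. by move=> le_fg [p gP]; exists p => x; apply: leq_trans (gP x). Qed.

Lemma poly_bound_const k : poly_bound m (fun=> k).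
Proof. by exists (k%:P)%R => x; rewrite hornerC. Qed.

Lemma poly_bound_id : poly_bound m m.
Proof. by exists 'X%R => x; rewrite hornerX. Qed.

Lemma poly_boundD f g :
  poly_bound m f -> poly_bound m g -> poly_bound m (fun x => f x + g x).
Proof.
by move=> [p fP] [q gP]; exists (p + q)%R => x; rewrite hornerD leq_add.
Qed.

Lemma poly_boundS f : poly_bound m f -> poly_bound m (fun x => (f x).+1).
Proof.
move=> fP; apply: poly_bound_le (poly_boundD fP (poly_bound_const 1)) => x.
by rewrite addn1.
Qed.

Lemma poly_boundM f g :
  poly_bound m f -> poly_bound m g -> poly_bound m (fun x => f x * g x).
Proof.
by move=> [p fP] [q gP]; exists (p * q)%R => x; rewrite hornerM leq_mul.
Qed.

Lemma poly_bound_horner p f :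
  poly_bound m f -> poly_bound m (fun x => (p.[f x])%R).
Proof.
move=> [q fP]; exists (p \Po q)%R => x.
by rewrite horner_comp horner_nat_le.
Qed.

Lemma poly_bound_trans f g :
  poly_bound m f -> poly_bound f g -> poly_bound m g.
Proof.
by move=> mf [p gP]; apply: poly_bound_le gP (poly_bound_horner p mf).
Qed.

Lemma poly_bound_comp Y (h : Y -> X) (f : X -> nat) :
  poly_bound m f -> poly_bound (m \o h) (f \o h).
Proof. by move=> [p fP]; exists p => y; apply: fP. Qed.

End PolyBound.

#[local] Hint Resolve poly_bound_const poly_bound_id poly_boundD poly_boundS
  poly_boundM poly_bound_horner : polyb.

(** * Total correctness with cost bounds for WHILE programs *)

Definition run (c : cmd) (s : store) (b : nat) (Q : store -> Prop) : Prop :=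
  exists n s', [/\ exec c s n s', n <= b & Q s'].

Lemma run_weaken c s b b' (Q Q' : store -> Prop) :
  b <= b' -> (forall s', Q s' -> Q' s') -> run c s b Q -> run c s b' Q'.
Proof.
move=> le_b sub [n [s' [ex le_n Qs']]]; exists n, s'.
by split; [| apply: leq_trans le_b | apply: sub].
Qed.

Lemma run_le c s b b' Q : b <= b' -> run c s b Q -> run c s b' Q.
Proof. by move=> le_b; apply: run_weaken. Qed.

Lemma run_assign s x e b (Q : store -> Prop) :
  eval_cost s e < b -> Q (update s x (eval s e)) -> run (Assign x e) s b Q.
Proof. by move=> lt_b Qs; do 2!eexists; split; [apply: exec_assign | | ]. Qed.

Lemma run_seq c1 c2 s b1 b2 Q :
  run c1 s b1 (fun s1 => run c2 s1 b2 Q) -> run (Seq c1 c2) s (b1 + b2) Q.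
Proof.
move=> [n1 [s1 [ex1 le1 [n2 [s2 [ex2 le2 Qs2]]]]]].
by exists (n1 + n2), s2; split; [apply: exec_seq ex2 | apply: leq_add |].
Qed.

Lemma run_if s e c1 c2 b Q :
  run (if is_nil (eval s e) then c2 else c1) s b Q ->
  run (If e c1 c2) s (eval_cost s e + b) Q.
Proof.
move=> [n [s' [ex le_n Qs']]]; exists (eval_cost s e + n), s'.
by split; [apply: exec_if | rewrite leq_add2l |].
Qed.

Lemma run_while s e c b1 b2 Q :
  ~~ is_nil (eval s e) ->
  run c s b1 (fun s1 => run (While e c) s1 b2 Q) ->
  run (While e c) s (eval_cost s e + b1 + b2) Q.
Proof.
move=> nz [n1 [s1 [ex1 le1 [n2 [s2 [ex2 le2 Qs2]]]]]].
exists (eval_cost s e + n1 + n2), s2; split=> //.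
  exact: exec_while_step ex2.
by rewrite !leq_add.
Qed.

Lemma eval_le_cost s e : tree_size (eval s e) <= eval_cost s e.
Proof. by case: e => *; apply: leq_addr. Qed.

(** Each evaluation is charged the size of its value, so a variable cannot grow by more than the
    time spent. This makes outputs polynomially small ([computable_size]), which is what lets
    programs be composed. *)
Lemma exec_size c s n s' i :
  exec c s n s' -> tree_size (s' i) <= tree_size (s i) + n.
Proof.
move=> ex; elim: ex i => {c s n s'} [s|s x e|c1 c2 s s1 s2 n1 n2 _ IH1 _ IH2
  |s e c1 c2 s' n _ IH|s e c _|s e c s1 s2 n1 n2 _ _ IH1 _ IH2] i;
  rewrite ?leq_addr //.
- rewrite /update; case: eqP => [->|_]; last exact: leq_addr.
  by have := eval_le_cost s e; lia.
- by have := IH1 i; have := IH2 i; lia.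
- by have := IH i; lia.
- by have := IH1 i; have := IH2 i; lia.
Qed.

(* Variables above [N] are preserved, and those up to [N] may initially hold  *)
(* garbage, so that programs compose without clearing their workspace.        *)
Definition computable (X : Type) (e f : X -> tree) : Prop :=
  exists c N, exists2 b, poly_bound (fun x => tree_size (e x)) b &
    forall x s, s 0 = e x ->
      run c s (b x) (fun s' => s' 0 = f x /\ forall i, N < i -> s' i = s i).

Lemma eq_computable X (e f g : X -> tree) :
  f =1 g -> computable e f -> computable e g.
Proof.
move=> fg [c [N [b bP runP]]]; exists c, N, b => // x s s0.
by rewrite -fg; apply: runP.
Qed.

Lemma computable_size X (e f : X -> tree) :
  computable e f ->
  poly_bound (fun x => tree_size (e x)) (fun x => tree_size (f x)).
Proof.
move=> [c [N [b bP runP]]].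
apply: poly_bound_le (poly_boundD (poly_bound_id _) bP) => x.
have [n [s' [ex le_n [<- _]]]] := runP x (init (e x)) erefl.
by apply: leq_trans (exec_size 0 ex) _; rewrite leq_add2l.
Qed.

Lemma computable_comp X Y (h : Y -> X) (e f : X -> tree) :
  computable e f -> computable (e \o h) (f \o h).
Proof.
move=> [c [N [b bP runP]]]; exists c, N, (b \o h).
  exact: (@poly_bound_comp _ _ _ h _ bP).
by move=> y s s0; apply: runP.
Qed.

Lemma computable_trans X (e f g : X -> tree) :
  computable e f -> computable f g -> computable e g.
Proof.
move=> ef; have sz := computable_size ef; move: ef.
move=> [c1 [N1 [b1 b1P run1]]] [c2 [N2 [b2 b2P run2]]].
exists (Seq c1 c2), (maxn N1 N2), (fun x => b1 x + b2 x).
  by apply: poly_boundD => //; apply: poly_bound_trans b2P.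
move=> x s s0; apply: run_seq.
apply: run_weaken (run1 x s s0) => // s1 [s10 s1i].
apply: run_weaken (run2 x s1 s10) => // s2 [s20 s2i]; split=> // i.
by rewrite gtn_max => /andP[? ?]; rewrite s2i // s1i.
Qed.

Lemma computable_id X (e : X -> tree) : computable e e.
Proof.
exists Skip, 0, (fun=> 1); first exact: poly_bound_const.
by move=> x s s0; exists 1, s; split; [apply: exec_skip | |].
Qed.

Lemma computable_nil X (e : X -> tree) : computable e (fun=> Nil).
Proof.
exists (Assign 0 ENil), 0, (fun=> 2); first exact: poly_bound_const.
move=> x s s0; apply: run_assign => //.
by split=> // i i0; rewrite /update gtn_eqF.
Qed.

(** The input is saved in [V], above both workspaces, so that it survives [c1] and can be restored
    for [c2]; the first result waits in [V.+1]. *)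
Lemma computable_cons X (e f g : X -> tree) :
  computable e f -> computable e g ->
  computable e (fun x => Cons (f x) (g x)).
Proof.
move=> ef eg; have szf := computable_size ef; have szg := computable_size eg.
move: ef eg => [c1 [N1 [b1 b1P run1]]] [c2 [N2 [b2 b2P run2]]].
pose V := (maxn N1 N2).+1.
exists (Seq (Assign V (EVar 0)) (Seq c1 (Seq (Assign V.+1 (EVar 0))
  (Seq (Assign 0 (EVar V)) (Seq c2 (Assign 0 (ECons (EVar V.+1) (EVar 0)))))))).
exists V.+1.
exists (fun x => (tree_size (e x)).+1 + (b1 x + ((tree_size (f x)).+1 +
  ((tree_size (e x)).+1 + (b2 x +
  (2 * (tree_size (f x) + tree_size (g x))).+2))))).
  by auto 20 with polyb.
move=> x s s0.
have N1V : N1 < V by rewrite ltnS leq_maxl.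
have N2V : N2 < V by rewrite ltnS leq_maxr.
apply: run_seq; apply: run_assign; first by rewrite /= s0 addn0.
apply: run_seq; apply: run_weaken (run1 x _ _) => // s1 [s10 s1i].
apply: run_seq; apply: run_assign; first by rewrite /= s10 addn0.
have s1V : s1 V = e x by rewrite s1i // /update eqxx.
apply: run_seq; apply: run_assign.
  by rewrite /= /update ltn_eqF // s1V addn0.
apply: run_seq.
apply: run_weaken (run2 x _ _) => // [s2 [s20 s2i]|]; last first.
  by rewrite /= /update eqxx (ltn_eqF (ltnSn V)).
have s2V : s2 V.+1 = f x by rewrite s2i /update /= ?eqxx //; lia.
apply: run_assign; first by rewrite /= s20 s2V; lia.
split; first by rewrite /update /= s2V s20.
clearbody V.
move=> i Vi; rewrite /update gtn_eqF ?(ltn_trans _ Vi) //.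
rewrite s2i; last by lia.
rewrite /update /= !gtn_eqF //; try lia.
rewrite s1i; last by lia.
by rewrite /update gtn_eqF //; lia.
Qed.

Lemma computable_fst X (e f g : X -> tree) :
  computable e (fun x => Cons (f x) (g x)) -> computable e f.
Proof.
move=> /computable_trans; apply.
exists (Assign 0 (EHead (EVar 0))), 0.
exists (fun x => (2 * tree_size (Cons (f x) (g x))).+2).
  exact: (poly_boundS (poly_boundS
    (poly_boundM (poly_bound_const _ 2) (poly_bound_id _)))).
move=> x s s0; apply: run_assign; first by rewrite /= s0 /=; lia.
by rewrite /update /= s0; split=> // i i0; rewrite gtn_eqF.
Qed.

Lemma computable_snd X (e f g : X -> tree) :
  computable e (fun x => Cons (f x) (g x)) -> computable e g.
Proof.
move=> /computable_trans; apply.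
exists (Assign 0 (ETail (EVar 0))), 0.
exists (fun x => (2 * tree_size (Cons (f x) (g x))).+2).
  exact: (poly_boundS (poly_boundS
    (poly_boundM (poly_bound_const _ 2) (poly_bound_id _)))).
move=> x s s0; apply: run_assign; first by rewrite /= s0 /=; lia.
by rewrite /update /= s0; split=> // i i0; rewrite gtn_eqF.
Qed.

Lemma tree_eqP : Equality.axiom tree_eqb.
Proof.
move=> t u; apply: (iffP idP) => [|<-].
  elim: t u => [|l IHl r IHr] [|l' r'] //= /andP[/IHl -> /IHr ->] //.
by elim: t => //= l -> r ->.
Qed.

Lemma computable_eq X (T : eqType) (enc : T -> tree) (e : X -> tree) f g :
  injective enc -> computable e (fun x => enc (f x)) ->
  computable e (fun x => enc (g x)) ->
  computable e (fun x => nat_tree (f x == g x)).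
Proof.
move=> enc_inj ef eg; apply: computable_trans (computable_cons ef eg) _.
set e' := fun x => Cons _ _.
exists (Assign 0 (EEq (EHead (EVar 0)) (ETail (EVar 0)))), 0.
exists (fun x => (6 * tree_size (e' x)).+3).
  exact: (poly_boundS (poly_boundS (poly_boundS
    (poly_boundM (poly_bound_const _ 6) (poly_bound_id _))))).
move=> x s s0; apply: run_assign.
  by rewrite /= s0 /=; case: tree_eqb => /=; lia.
split; last by move=> i i0; rewrite /update gtn_eqF.
rewrite /update /= s0 /=.
have -> : tree_eqb (enc (f x)) (enc (g x)) = (f x == g x).
  by apply/tree_eqP/eqP => [/enc_inj|->].
by case: eqP.
Qed.

(** The environment paired with a nonempty list is literally the tree that the branch [F] expects,
    so after one test the store is handed on unchanged. *)
Lemma computable_case X (T : Type) (enc : T -> tree) (e : X -> tree)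
    (l : X -> seq T) (F : X -> T -> seq T -> tree) (G : X -> tree) :
  computable e (fun x => list_tree enc (l x)) ->
  computable e G ->
  computable
    (fun z : X * (T * seq T) =>
       Cons (e z.1) (Cons (enc z.2.1) (list_tree enc z.2.2)))
    (fun z => F z.1 z.2.1 z.2.2) ->
  computable e (fun x => if l x is y :: r then F x y r else G x).
Proof.
move=> el eG eF.
apply: computable_trans (computable_cons (computable_id e) el) _.
have {}eG : computable (fun x => Cons (e x) (list_tree enc (l x))) G.
  by apply: computable_trans eG; apply: computable_fst (computable_id _).
move: eF eG => [c1 [N1 [b1 [p b1P] run1]]] [c2 [N2 [b2 b2P run2]]].
set e' := fun x => Cons _ _.
exists (If (ETail (EVar 0)) c1 c2), (maxn N1 N2).
exists (fun x => (2 * tree_size (e' x)).+1 + ((p.[tree_size (e' x)])%R + b2 x)).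
  apply: poly_boundD; last first.
    by apply: poly_boundD => //; apply: poly_bound_horner; apply: poly_bound_id.
  exact: (poly_boundS (poly_boundM (poly_bound_const _ 2) (poly_bound_id _))).
move=> x s s0.
apply: (run_le (b := eval_cost s (ETail (EVar 0)) +
                     ((p.[tree_size (e' x)])%R + b2 x))).
  by rewrite leq_add2r /= s0 /=; lia.
apply: run_if; rewrite /= s0 /=; case lx: (l x) => [|y r] /=.
  apply: run_weaken (run2 x s s0) => [|s' [s'0 s'i]]; first exact: leq_addl.
  by split=> // i; rewrite gtn_max => /andP[_ /s'i].
apply: run_weaken (run1 (x, (y, r)) s _) => [|s' [s'0 s'i]|].
- by apply: leq_trans (leq_addr _ _); apply: b1P (x, (y, r)).
- by split=> // i; rewrite gtn_max => /andP[/s'i].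
by rewrite s0 /e' /= lx.
Qed.

Lemma computable_if X (e : X -> tree) (b : X -> bool) (f g : X -> tree) :
  computable e (fun x => nat_tree (b x)) -> computable e f -> computable e g ->
  computable e (fun x => if b x then f x else g x).
Proof.
move=> eb ef eg.
(* The code of a boolean is also the code of a list of zero or one units, so a conditional is a case
   distinction on lists. *)
pose l x := nseq (b x) tt.
apply: (eq_computable (f := fun x => if l x is _ :: _ then f x else g x)).
  by move=> x; rewrite /l; case: (b x).
apply: (computable_case (enc := fun=> Nil) (F := fun x _ _ => f x)) => //.
  by apply: eq_computable eb => x; rewrite /l; case: (b x).
apply: computable_trans (computable_comp fst ef).
exact: computable_fst (computable_id _).
Qed.

Lemma list_tree_size_le (T : eqType) (enc : T -> tree) (l : seq T) M :
  {in l, forall t, tree_size (enc t) <= M} ->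
  tree_size (list_tree enc l) <= (size l * M.+1).+1.
Proof.
elim: l => //= t l IH le_M; rewrite mulSn.
have le_t := le_M t (mem_head t l).
have : tree_size (list_tree enc l) <= (size l * M.+1).+1.
  by apply: IH => u ul; apply: le_M; rewrite inE ul orbT.
by lia.
Qed.

Lemma size_le_list_tree (T : Type) (enc : T -> tree) (l : seq T) :
  size l < tree_size (list_tree enc l).
Proof. by elim: l => //= t l; lia. Qed.

Lemma mem_list_tree_size (T : eqType) (enc : T -> tree) (l : seq T) t :
  t \in l -> tree_size (enc t) <= tree_size (list_tree enc l).
Proof. by elim: l => //= u l IH; rewrite inE => /predU1P[-> | /IH]; lia. Qed.

(** * Loops over lists *)

Section Foldl.

Variables (X T S : Type) (encT : T -> tree) (encS : S -> tree) (e : X -> tree).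
Variables (F : X -> S -> T -> S) (c : cmd) (N : nat) (b : X * S * T -> nat).

Let V := N.+1.

Definition foldl_body : cmd :=
  Seq (Assign 0 (ECons (EVar V) (ECons (EVar V.+1) (EHead (EVar V.+2)))))
    (Seq c (Seq (Assign V.+1 (EVar 0)) (Assign V.+2 (ETail (EVar V.+2))))).

Hypothesis runF : forall z s,
  s 0 = Cons (e z.1.1) (Cons (encS z.1.2) (encT z.2)) ->
  run c s (b z)
    (fun s' => s' 0 = encS (F z.1.1 z.1.2 z.2) /\
               forall i, N < i -> s' i = s i).

Lemma run_foldl x l st s B C :
  s V = e x -> s V.+1 = encS st -> s V.+2 = list_tree encT l ->
  tree_size (e x) <= B -> tree_size (list_tree encT l) <= B ->
  (forall k, tree_size (encS (foldl (F x) st (take k l))) <= B) ->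
  (forall st t, tree_size (encS st) <= B -> tree_size (encT t) <= B ->
     b (x, st, t) <= C) ->
  run (While (EVar V.+2) foldl_body) s ((size l).+1 * (C + 20 * B.+1))
    (fun s' => s' V.+1 = encS (foldl (F x) st l) /\
               forall i, V.+2 < i -> s' i = s i).
Proof.
elim: l st s => [|t l IH] st s sV sV1 sV2 leB lelB lestB leC.
  exists (eval_cost s (EVar V.+2)), s; split=> //.
    by apply: exec_while_done; rewrite /= sV2.
  by rewrite /= sV2 /=; lia.
have lestB0 := lestB 0; have lestB1 := lestB 1.
rewrite /= take0 /= in lestB0 lestB1.
rewrite /= in lelB.
apply: (run_le (b := eval_cost s (EVar V.+2) +
    (10 * B.+1 + (C + (B.+1 + (B + B).+1))) + (size l).+1 * (C + 20 * B.+1))).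
  by rewrite /= sV2 /= mulSn; lia.
apply: run_while; first by rewrite /= sV2.
apply: run_seq; apply: run_assign; first by rewrite /= sV sV1 sV2 /=; lia.
apply: run_seq; apply: run_weaken (runF (z := (x, st, t)) _).
- by apply: leC; lia.
- move=> s1 [s10 s1i]; apply: run_seq; apply: run_assign.
    by rewrite /= s10 /=; lia.
  apply: run_assign.
    rewrite /= /update !gtn_eqF // s1i; last by rewrite /V; lia.
    by rewrite /update /= sV2 /=; lia.
  set s2 := update _ _ _.
  have s2E i : V.+2 < i -> s2 i = s i.
    move=> Vi; rewrite /s2 /update !gtn_eqF; try lia.
    rewrite s1i; last by rewrite /V in Vi; lia.
    by rewrite /update gtn_eqF //; lia.
  apply: run_weaken (IH (F x st t) s2 _ _ _ _ _ _ _) => //.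
  + by move=> s' [? s'i]; split=> // i Vi; rewrite s'i // s2E.
  + rewrite /s2 /update !ltn_eqF //.
    by rewrite s1i // /update.
  + by rewrite /s2 /update (ltn_eqF (ltnSn _)) eqxx /= s10.
  + rewrite /s2 /update eqxx /= gtn_eqF // s1i; last by rewrite /V; lia.
    by rewrite /update /= sV2.
  + by lia.
  + by move=> k; apply: lestB k.+1.
by rewrite /update /= sV sV1 sV2.
Qed.

End Foldl.

(** A polynomial-time body is not enough: a state that doubles in each round becomes exponential.
    Hence the bound [B] on the states after all prefixes of the list; with it, every round costs a
    polynomial in the size of the original input. *)
Lemma computable_foldl X (T S : Type) (encT : T -> tree) (encS : S -> tree)
    (e : X -> tree) (F : X -> S -> T -> S) (st : X -> S) (l : X -> seq T)
    (B : X -> nat) :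
  computable e (fun x => encS (st x)) ->
  computable e (fun x => list_tree encT (l x)) ->
  computable
    (fun z : X * S * T => Cons (e z.1.1) (Cons (encS z.1.2) (encT z.2)))
    (fun z => encS (F z.1.1 z.1.2 z.2)) ->
  poly_bound (fun x => tree_size (e x)) B ->
  (forall x k, tree_size (encS (foldl (F x) (st x) (take k (l x)))) <= B x) ->
  computable e (fun x => encS (foldl (F x) (st x) (l x))).
Proof.
move=> es el [c [N [b [p bP] runF]]] Bp leB.
have lp := computable_size el.
apply: computable_trans
  (computable_cons (computable_id e) (computable_cons es el)) _.
set e' := fun x => Cons _ _.
have e'P : poly_bound (fun x => tree_size (e' x)) (fun x => tree_size (e x)).
  by apply: poly_bound_le (poly_bound_id _) => x /=; lia.
pose B' x := tree_size (e x) + tree_size (list_tree encT (l x)) + B x.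
have B'P : poly_bound (fun x => tree_size (e' x)) B'.
  by apply: poly_bound_trans e'P _; rewrite /B'; auto with polyb.
(* The body reads environment, state and item, each of size at most [B' x], joined by two [Cons]
   nodes; [3 * (B' x).+1] covers this. *)
pose V := N.+1; pose C x := (p.[3 * (B' x).+1])%R.
exists (Seq (Assign V (EHead (EVar 0)))
  (Seq (Assign V.+1 (EHead (ETail (EVar 0))))
  (Seq (Assign V.+2 (ETail (ETail (EVar 0))))
  (Seq (While (EVar V.+2) (foldl_body c N)) (Assign 0 (EVar V.+1)))))), V.+2.
exists (fun x => (2 * tree_size (e' x)).+1 + ((3 * tree_size (e' x)).+1 +
  ((3 * tree_size (e' x)).+1 +
  ((tree_size (e' x)).+1 * (C x + 20 * (B' x).+1) + (2 * B' x).+1)))).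
  rewrite /C; auto 20 with polyb.
move=> x s s0.
apply: run_seq; apply: run_assign; first by rewrite /= s0 /=; lia.
apply: run_seq; apply: run_assign; first by rewrite /update /= s0 /=; lia.
apply: run_seq; apply: run_assign; first by rewrite /update /= s0 /=; lia.
set s1 := update _ _ _.
have loop := @run_foldl _ _ _ encT encS e F c N b runF x (l x) (st x) s1
  (B' x) (C x).
apply: run_seq; apply: run_weaken (loop _ _ _ _ _ _ _).
- rewrite leq_mul2r; apply/orP; right.
  by have := size_le_list_tree encT (l x); rewrite /=; lia.
- move=> s2 [s2V s2i]; apply: run_assign.
    by rewrite /= s2V; have := leB x (size (l x)); rewrite take_size /B'; lia.
  split; first by rewrite /update /= s2V.
  move=> i Vi; rewrite /update gtn_eqF; last by lia.
  by rewrite s2i // /s1 /update !gtn_eqF //; lia.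
- by rewrite /s1 /update [V == V.+2]ltn_eqF // [V == V.+1]ltn_eqF // eqxx /= s0.
- by rewrite /s1 /update /= ltn_eqF // eqxx s0.
- by rewrite /s1 /update /= eqxx s0.
- by rewrite /B'; lia.
- by rewrite /B'; lia.
- by move=> k; have := leB x k; rewrite /B'; lia.
move=> u t leu let_; apply: leq_trans (bP _) _; apply: horner_nat_le => /=.
have : tree_size (e x) <= B' x by rewrite /B'; lia.
by lia.
Qed.

(** * Environments of loop bodies and branches; pairs, lists and association lists *)

Definition foldl_ctx (X S T : Type) (e : X -> tree) (encS : S -> tree)
    (encT : T -> tree) (z : X * S * T) : tree :=
  Cons (e z.1.1) (Cons (encS z.1.2) (encT z.2)).

Definition case_ctx (X T : Type) (e : X -> tree) (enc : T -> tree)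
    (z : X * (T * seq T)) : tree :=
  Cons (e z.1) (Cons (enc z.2.1) (list_tree enc z.2.2)).

Section Contexts.

Variables (X S T : Type) (e : X -> tree) (encS : S -> tree) (encT : T -> tree).

(** Whatever is computable outside a loop is computable inside it, since the environment is part of
    the input of the body. *)
Lemma foldl_ctx_env f :
  computable e f -> computable (foldl_ctx e encS encT) (fun z => f z.1.1).
Proof.
move=> ef; apply: computable_trans (computable_comp (fun z => z.1.1) ef).
exact: (computable_fst (computable_id (foldl_ctx e encS encT))).
Qed.

Lemma foldl_ctx_state :
  computable (foldl_ctx e encS encT) (fun z => encS z.1.2).
Proof.
apply: (computable_fst (g := fun z => encT z.2)).
exact: (computable_snd (computable_id (foldl_ctx e encS encT))).
Qed.

Lemma foldl_ctx_item :
  computable (foldl_ctx e encS encT) (fun z => encT z.2).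
Proof.
apply: (computable_snd (f := fun z => encS z.1.2)).
exact: (computable_snd (computable_id (foldl_ctx e encS encT))).
Qed.

Lemma case_ctx_env f :
  computable e f -> computable (case_ctx e encT) (fun z => f z.1).
Proof.
move=> ef; apply: computable_trans (computable_comp fst ef).
exact: (computable_fst (computable_id (case_ctx e encT))).
Qed.

Lemma case_ctx_head :
  computable (case_ctx e encT) (fun z => encT z.2.1).
Proof.
apply: (computable_fst (g := fun z => list_tree encT z.2.2)).
exact: (computable_snd (computable_id (case_ctx e encT))).
Qed.

Lemma case_ctx_tail :
  computable (case_ctx e encT) (fun z => list_tree encT z.2.2).
Proof.
apply: (computable_snd (f := fun z => encT z.2.1)).
exact: (computable_snd (computable_id (case_ctx e encT))).
Qed.

End Contexts.

Definition pair_tree (T U : Type) (encT : T -> tree) (encU : U -> tree)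
  (p : T * U) : tree := Cons (encT p.1) (encU p.2).

Section Pairs.

Variables (X T U : Type) (e : X -> tree) (encT : T -> tree) (encU : U -> tree).

Lemma computable_pair f g :
  computable e (fun x => encT (f x)) -> computable e (fun x => encU (g x)) ->
  computable e (fun x => pair_tree encT encU (f x, g x)).
Proof. exact: computable_cons. Qed.

Lemma computable_pair1 p :
  computable e (fun x => pair_tree encT encU (p x)) ->
  computable e (fun x => encT (p x).1).
Proof. exact: computable_fst. Qed.

Lemma computable_pair2 p :
  computable e (fun x => pair_tree encT encU (p x)) ->
  computable e (fun x => encU (p x).2).
Proof. exact: computable_snd. Qed.

End Pairs.

Lemma pair_tree_inj (T U : Type) (encT : T -> tree) (encU : U -> tree) :
  injective encT -> injective encU -> injective (pair_tree encT encU).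
Proof. by move=> injT injU [t u] [t' u'] [/injT -> /injU ->]. Qed.

Lemma list_tree_inj (T : Type) (enc : T -> tree) :
  injective enc -> injective (list_tree enc).
Proof.
by move=> inj_enc; elim=> [|t l IH] [|t' l'] //= [/inj_enc -> /IH ->].
Qed.

Lemma list_tree_catrev_size (T : Type) (enc : T -> tree) (l r : seq T) :
  tree_size (list_tree enc (catrev l r)) <
  tree_size (list_tree enc l) + tree_size (list_tree enc r).
Proof. elim: l r => [|t l IH] r /=; first by lia.
by have := IH (t :: r) => /=; lia.
Qed.

Lemma list_tree_take_size (T : Type) (enc : T -> tree) (l : seq T) k :
  tree_size (list_tree enc (take k l)) <= tree_size (list_tree enc l).
Proof.
elim: l k => [|t l IH] [|k] //=.
by have := IH k; lia.
Qed.

Lemma foldl_cons_map (T U : Type) (f : T -> U) (l : seq T) (r : seq U) :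
  foldl (fun a t => f t :: a) r l = catrev (map f l) r.
Proof. by elim: l r => //= t l IH r; rewrite IH. Qed.

Lemma computable_cons_list (X T : Type) (e : X -> tree) (enc : T -> tree) t l :
  computable e (fun x => enc (t x)) ->
  computable e (fun x => list_tree enc (l x)) ->
  computable e (fun x => list_tree enc (t x :: l x)).
Proof. exact: computable_cons. Qed.

Section Lists.

Variables (X T : Type) (e : X -> tree) (enc : T -> tree).

Lemma computable_catrev l r :
  computable e (fun x => list_tree enc (l x)) ->
  computable e (fun x => list_tree enc (r x)) ->
  computable e (fun x => list_tree enc (catrev (l x) (r x))).
Proof.
move=> el er.
apply: (eq_computable (f := fun x =>
  list_tree enc (foldl (fun a t => t :: a) (r x) (l x)))).
  by move=> x; rewrite (foldl_cons_map id) map_id.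
apply: (computable_foldl (F := fun _ a t => t :: a) er el
  (B := fun x => tree_size (list_tree enc (l x)) +
                 tree_size (list_tree enc (r x)))).
- exact: computable_cons_list (foldl_ctx_item _ _ _) (foldl_ctx_state _ _ _).
- by apply: poly_boundD; apply: computable_size.
move=> x k; rewrite (foldl_cons_map id) map_id.
have := list_tree_catrev_size enc (take k (l x)) (r x).
by have := list_tree_take_size enc (l x) k; lia.
Qed.

Lemma computable_rev l :
  computable e (fun x => list_tree enc (l x)) ->
  computable e (fun x => list_tree enc (rev (l x))).
Proof. by move=> el; apply: computable_catrev => //; apply: computable_nil. Qed.

Lemma computable_cat l r :
  computable e (fun x => list_tree enc (l x)) ->
  computable e (fun x => list_tree enc (r x)) ->
  computable e (fun x => list_tree enc (l x ++ r x)).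
Proof.
move=> el er.
apply: (eq_computable (f := fun x => list_tree enc (catrev (rev (l x)) (r x)))).
  by move=> x; rewrite catrevE revK.
by apply: computable_catrev => //; apply: computable_rev.
Qed.

Lemma computable_head l :
  computable e (fun x => list_tree (list_tree enc) (l x)) ->
  computable e (fun x => list_tree enc (head [::] (l x))).
Proof.
move=> el.
apply: (eq_computable (f := fun x =>
  if l x is w :: _ then list_tree enc w else Nil)).
  by move=> x; case: (l x).
apply: (computable_case (F := fun _ w _ => list_tree enc w) el).
  exact: computable_nil.
exact: (case_ctx_head e (list_tree enc)).
Qed.

End Lists.

Lemma computable_map (X : Type) (T U : eqType) (e : X -> tree)
    (encT : T -> tree) (encU : U -> tree) (f : X -> T -> U) l :
  computable e (fun x => list_tree encT (l x)) ->
  computable (fun z : X * T => Cons (e z.1) (encT z.2))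
             (fun z => encU (f z.1 z.2)) ->
  computable e (fun x => list_tree encU [seq f x t | t <- l x]).
Proof.
move=> el ef.
apply: (eq_computable (f := fun x =>
  list_tree encU (rev (foldl (fun a t => f x t :: a) [::] (l x))))).
  by move=> x; rewrite foldl_cons_map -/(rev _) revK.
apply: computable_rev; have [p pP] := computable_size ef.
pose M x := (p.[(tree_size (e x) + tree_size (list_tree encT (l x))).+1])%R.
apply: (computable_foldl (F := fun x a t => f x t :: a)
  (st := fun=> [::]) (encS := list_tree encU) (computable_nil _) el
  (B := fun x => (tree_size (list_tree encT (l x)) * (M x).+1).+1)).
- apply: computable_cons_list; last exact: foldl_ctx_state.
  apply: computable_trans _
    (computable_comp (fun z : X * _ * T => (z.1.1, z.2)) ef).
  apply: computable_cons; last exact: foldl_ctx_item.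
  exact: (foldl_ctx_env _ _ (computable_id e)).
- rewrite /M; have := computable_size el; auto 20 with polyb.
move=> x k; rewrite foldl_cons_map -/(rev _).
apply: leq_trans (list_tree_size_le (M := M x) _) _.
  move=> u; rewrite mem_rev => /mapP[t /mem_take tl ->].
  apply: leq_trans (pP (x, t)) _; apply: horner_nat_le => /=.
  by rewrite ltnS leq_add2l mem_list_tree_size.
rewrite ltnS size_rev size_map leq_mul2r; apply/orP; right.
by have := size_le_list_tree encT (l x); rewrite size_take_min; lia.
Qed.

(** All values under the key are collected. Emptiness means absence, and when one value is wanted
    the head is taken; which one it is does not matter, so [mem_lookup] is the only
    specification. *)
Definition lookup (K : eqType) (T : Type) (k : K) (l : seq (K * T)) : seq T :=
  foldl (fun r e => if e.1 == k then e.2 :: r else r) [::] l.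

Lemma mem_lookup (K T : eqType) (k : K) (l : seq (K * T)) v :
  (v \in lookup k l) = ((k, v) \in l).
Proof.
rewrite /lookup -[RHS]orbF -(in_nil v); elim: l [::] => //= [[k' v'] l] IH r.
rewrite IH inE xpair_eqE /= [k' == k]eq_sym; case: eqP => _ //=.
by rewrite inE orbCA orbA.
Qed.

Lemma computable_lookup (X : Type) (K T : eqType) (e : X -> tree)
    (encK : K -> tree) (encT : T -> tree) k l :
  injective encK ->
  computable e (fun x => encK (k x)) ->
  computable e (fun x => list_tree (pair_tree encK encT) (l x)) ->
  computable e (fun x => list_tree encT (lookup (k x) (l x))).
Proof.
move=> inj ek el.
apply: (computable_foldl
  (F := fun x r (v : K * T) => if v.1 == k x then v.2 :: r else r)
  (st := fun=> [::]) (encS := list_tree encT) (computable_nil _) el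
  (B := fun x => tree_size (list_tree (pair_tree encK encT) (l x)))).
- have item := foldl_ctx_item e (list_tree encT) (pair_tree encK encT).
  pose ctx := foldl_ctx e (list_tree encT) (pair_tree encK encT).
  apply: (eq_computable (e := ctx) (f := fun z =>
    if z.2.1 == k z.1.1 then list_tree encT (z.2.2 :: z.1.2)
    else list_tree encT z.1.2)); first by move=> z; case: ifP.
  apply: computable_if; last exact: foldl_ctx_state.
    exact: computable_eq inj (computable_pair1 item) (foldl_ctx_env _ _ ek).
  exact: computable_cons_list (computable_pair2 item) (foldl_ctx_state _ _ _).
- exact: computable_size.
move=> x i; apply: leq_trans (list_tree_take_size _ (l x) i).
set l' := take i (l x); rewrite -[leqRHS]addn0.
(* This form of [0] lets the induction generalise the accumulator. *)
have -> : 0 = (tree_size (list_tree encT [::])).-1 by [].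
elim: l' [::] => [|v l' IH] r /=.
  by case: r => //= *; lia.
apply: leq_trans (IH _) _.
by case: ifP => _ /=; lia.
Qed.

(** * The algorithm and its running time *)

Lemma foldl_iter (S T : Type) (f : S -> S) s (l : seq T) :
  foldl (fun s _ => f s) s l = iter (size l) f s.
Proof. by elim: l s => //= _ l IH s; rewrite IH -iterSr. Qed.

(** The list [l] serves only as a unary counter. *)
Lemma computable_iter X (S T : Type) (encS : S -> tree) (encT : T -> tree)
    (e : X -> tree) (f : X -> S -> S) (st : X -> S) (l : X -> seq T)
    (B : X -> nat) :
  computable e (fun x => encS (st x)) ->
  computable e (fun x => list_tree encT (l x)) ->
  computable (fun z : X * S => Cons (e z.1) (encS z.2))
    (fun z => encS (f z.1 z.2)) ->
  poly_bound (fun x => tree_size (e x)) B ->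
  (forall x k, k <= size (l x) ->
     tree_size (encS (iter k (f x) (st x))) <= B x) ->
  computable e (fun x => encS (iter (size (l x)) (f x) (st x))).
Proof.
move=> es el ef Bp leB.
apply: (eq_computable (f := fun x =>
  encS (foldl (fun s _ => f x s) (st x) (l x)))).
  by move=> x; rewrite foldl_iter.
apply: (computable_foldl (F := fun x s _ => f x s) es el _ Bp).
  apply: computable_trans _ (computable_comp (fun z : X * S * T => z.1) ef).
  apply: computable_cons; last exact: foldl_ctx_state.
  exact: foldl_ctx_env (computable_id e).
by move=> x k; rewrite foldl_iter size_take_min leB // geq_minr.
Qed.

Section Algorithm.

Variable A : finType.

Implicit Types (a : letter A) (u v w g h : word A) (hs : seq (word A)).

Definition linv a : letter A := (a.1, ~~ a.2).

(* ((p, a), q) is an edge from p to q labelled a; p and a are paired because  *)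
(* the folding algorithm looks edges up by source and label.                  *)
Definition edge : Type := (word A * letter A) * word A.
Implicit Types (d : edge) (E : seq edge).

Definition redirect u v x : word A := if x == u then v else x.

Definition merge u v E : seq edge :=
  [seq (redirect u v d.1.1, d.1.2, redirect u v d.2) | d <- E].

(* Vertices are named by reversed words: u stands for the coset H (rev u).    *)
Definition path_step (s : word A * seq edge) a : word A * seq edge :=
  (a :: s.1, (s.1, a, a :: s.1) :: (a :: s.1, linv a, s.1) :: s.2).

Definition add_path E h : word A * seq edge := foldl path_step ([::], E) h.

(** Renaming the end of the path to the base closes it to a loop. Names of different loops may
    coincide, which is harmless: a name determines its coset. *)
Definition add_loop E h : seq edge :=
  merge (add_path E h).1 [::] (add_path E h).2.

Definition bouquet hs : seq edge := foldl add_loop [::] hs.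

(* ((source, target) of the path read off g, (edges already known to be       *)
(* deterministic, edges still to be scanned))                                 *)
Definition fold_state : Type := (word A * word A) * (seq edge * seq edge).

(** When two edges share source and label, one is dropped and its target renamed. The scan then
    restarts from scratch, because the renaming may create clashes among edges already scanned. *)
Definition fold_step (s : fold_state) : fold_state :=
  if s.2.2 is d :: todo then
    if lookup d.1 s.2.1 is v :: _ then
      (redirect d.2 v s.1.1, redirect d.2 v s.1.2,
       ([::], merge d.2 v (catrev s.2.1 todo)))
    else (s.1, (d :: s.2.1, todo))
  else s.

Definition fold_graph (s : fold_state) : fold_state :=
  iter (size s.2.2 * size s.2.2) fold_step s.

Definition extend_step (L : seq (word A * word A)) L' d :=
  if lookup d.2 L is w :: _ then (d.1.1, d.1.2 :: w) :: L' else L'.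

Definition extend E L : seq (word A * word A) := foldl (extend_step L) [::] E.

(** The search runs backwards from the final vertex, so words grow at the front. The first nonempty
    answer for [v] is kept. *)
Definition search_step E v (s : seq (word A * word A) * seq (word A)) :=
  (extend E s.1, if s.2 is w :: r then w :: r else lookup v (extend E s.1)).

Definition search E u v g : seq (word A * word A) * seq (word A) :=
  iter (size g) (search_step E v) ([:: (u, [::])], lookup v [:: (u, [::])]).

Definition closest (i : seq (word A) * word A) : word A :=
  let p := add_path (bouquet i.1) i.2 in
  let s := fold_graph ([::], p.1, ([::], p.2)) in
  i.2 ++ head [::] (search s.2.1 s.1.1 s.1.2 i.2).2.

(** * Encodings, sizes and running times of the stages of the algorithm *)

Lemma nat_tree_inj : injective nat_tree.
Proof. by elim=> [|m IH] [|n] //= [/IH ->]. Qed.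

Lemma letter_tree_inj : injective (@letter_tree A).
Proof.
move=> [a b] [a' b'] [/nat_tree_inj ra /nat_tree_inj rb]; congr (_, _).
  by apply: enum_rank_inj; apply: val_inj.
by move: rb; case: b; case: b'.
Qed.

Lemma word_tree_inj : injective (@word_tree A).
Proof. exact: list_tree_inj letter_tree_inj. Qed.

Let wt := @word_tree A.
Let key_tree := pair_tree wt (@letter_tree A).
Definition edge_tree :=
  pair_tree (pair_tree (@word_tree A) (@letter_tree A)) (@word_tree A).
Let edges_tree := list_tree edge_tree.

Lemma key_tree_inj : injective key_tree.
Proof. exact: pair_tree_inj word_tree_inj letter_tree_inj. Qed.

Section Context.

Variables (X : Type) (e : X -> tree).

Lemma computable_linv (a : X -> letter A) :
  computable e (fun x => letter_tree (a x)) ->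
  computable e (fun x => letter_tree (linv (a x))).
Proof.
move=> ea; apply: computable_cons; first exact: computable_fst ea.
apply: (eq_computable (f := fun x => if (a x).2 then Nil else Cons Nil Nil)).
  by move=> x /=; case: (a x).2.
apply: computable_if; first exact: computable_snd ea.
  exact: computable_nil.
by apply: computable_cons; apply: computable_nil.
Qed.

Lemma computable_redirect (u v x : X -> word A) :
  computable e (fun i => wt (u i)) -> computable e (fun i => wt (v i)) ->
  computable e (fun i => wt (x i)) ->
  computable e (fun i => wt (redirect (u i) (v i) (x i))).
Proof.
move=> eu ev ex; apply: (eq_computable (f := fun i =>
  if x i == u i then wt (v i) else wt (x i))).
  by move=> i; rewrite /redirect; case: ifP.
by apply: computable_if => //; apply: computable_eq word_tree_inj _ _.
Qed.

End Context.

Lemma computable_merge X (e : X -> tree) (u v : X -> word A)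
    (E : X -> seq edge) :
  computable e (fun i => wt (u i)) -> computable e (fun i => wt (v i)) ->
  computable e (fun i => edges_tree (E i)) ->
  computable e (fun i => edges_tree (merge (u i) (v i) (E i))).
Proof.
move=> eu ev eE; apply: (computable_map (f := fun i d =>
  (redirect (u i) (v i) d.1.1, d.1.2, redirect (u i) (v i) d.2)) eE).
set e' := fun z => Cons _ _.
have env f : computable e f -> computable e' (fun z => f z.1).
  move=> ef; apply: computable_trans (computable_comp fst ef).
  exact: computable_fst (computable_id e').
have item : computable e' (fun z => edge_tree z.2).
  exact: computable_snd (computable_id e').
have item1 := computable_pair1 item; have item2 := computable_pair2 item.
apply: computable_pair.
  apply: computable_pair; last exact: computable_pair2 item1.
  exact: computable_redirect (env _ eu) (env _ ev) (computable_pair1 item1).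
exact: computable_redirect (env _ eu) (env _ ev) item2.
Qed.

Lemma linv_size a :
  tree_size (letter_tree (linv a)) <= (tree_size (letter_tree a)).+2.
Proof. by case: a => a [] /=; lia. Qed.

Lemma word_tree_cons_size a u :
  tree_size (wt (a :: u)) = (tree_size (letter_tree a) + tree_size (wt u)).+1.
Proof. by []. Qed.

Lemma edges_tree_cons_size u a v E :
  tree_size (edges_tree ((u, a, v) :: E)) =
  (tree_size (wt u) + tree_size (letter_tree a) + tree_size (wt v) +
   tree_size (edges_tree E)).+3.
Proof. by rewrite /edges_tree /edge_tree /wt /=; lia. Qed.

(** Every vertex on the path has a name of size at most [m]. A step adds two edges, whose trees
    together take at most [4 * (|u| + |a|) + 10] nodes, where [|u|] and [|a|] are tree sizes; this
    is below [10 * m]. *)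
Lemma foldl_path_step_size u E h :
  let s := foldl path_step (u, E) h in
  let m := tree_size (wt u) + tree_size (wt h) in
  tree_size (wt s.1) <= m /\
  tree_size (edges_tree s.2) <=
    tree_size (edges_tree E) + size h * (10 * m).
Proof.
elim: h u E => [|a h IH] u E; first by rewrite /=; lia.
have eqm : tree_size (wt (a :: u)) + tree_size (wt h) =
           tree_size (wt u) + tree_size (wt (a :: h)).
  by rewrite !word_tree_cons_size; lia.
have := IH (a :: u) ((u, a, a :: u) :: (a :: u, linv a, u) :: E).
rewrite eqm !edges_tree_cons_size [foldl _ _ (a :: h)]/=.
rewrite !word_tree_cons_size; have := linv_size a.
move: (foldl _ _ _) => s lea; cbv zeta => -[les1 les2]; split=> //.
apply: leq_trans les2 _.
by rewrite (_ : size (a :: h) = (size h).+1) // mulSn; lia.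
Qed.

Lemma computable_add_path X (e : X -> tree) (E : X -> seq edge)
    (h : X -> word A) :
  computable e (fun x => edges_tree (E x)) ->
  computable e (fun x => wt (h x)) ->
  computable e (fun x => pair_tree wt edges_tree (add_path (E x) (h x))).
Proof.
move=> eE eh; pose m x := (tree_size (wt (h x))).+1.
have es : computable e (fun x => pair_tree wt edges_tree ([::], E x)).
  by apply: computable_pair => //; apply: computable_nil.
apply: (computable_foldl (F := fun=> path_step) es eh (B := fun x =>
  (m x + (tree_size (edges_tree (E x)) + m x * (10 * m x))).+1)).
- have st := foldl_ctx_state e (pair_tree wt edges_tree) (@letter_tree A).
  have st1 := computable_pair1 st; have st2 := computable_pair2 st.
  have item := foldl_ctx_item e (pair_tree wt edges_tree) (@letter_tree A).
  have st1' := computable_cons_list item st1.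
  apply: computable_pair => //; apply: computable_cons_list.
    by apply: computable_pair => //; apply: computable_pair.
  apply: computable_cons_list st2.
  apply: computable_pair => //; apply: computable_pair => //.
  exact: computable_linv.
- rewrite /m; have := computable_size eE; have := computable_size eh.
  by auto 20 with polyb.
move=> x k; have := foldl_path_step_size [::] (E x) (take k (h x)).
have := list_tree_take_size (@letter_tree A) (h x) k.
have := size_le_list_tree (@letter_tree A) (take k (h x)).
rewrite -/(word_tree (h x)) -/(word_tree (take k (h x))) -/wt /m.
set n := size _; set M := tree_size (wt (h x)).
set M' := tree_size (wt (take _ _)) => nM' M'M [s1 s2].
rewrite /= ltnS; apply: leq_add.
  by apply: leq_trans s1 _; rewrite /= add1n.
apply: leq_trans s2 _; rewrite leq_add2l leq_mul //; first by lia.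
by rewrite leq_mul2l /= add1n.
Qed.

(** No word has a smaller tree than [[::]], so closing loops at the base never enlarges the
    graph. *)
Lemma merge_nil_size u E :
  tree_size (edges_tree (merge u [::] E)) <= tree_size (edges_tree E).
Proof.
have redir v : tree_size (wt (redirect u [::] v)) <= tree_size (wt v).
  rewrite /redirect; case: ifP => // _.
  have := size_le_list_tree (@letter_tree A) v.
  by rewrite /wt /word_tree /=; lia.
elim: E => // -[[p a] q] E; have := redir p; have := redir q.
rewrite /merge map_cons !edges_tree_cons_size -/(merge _ _ _) /fst /snd.
by lia.
Qed.

Lemma computable_bouquet X (e : X -> tree) (hs : X -> seq (word A)) :
  computable e (fun x => list_tree wt (hs x)) ->
  computable e (fun x => edges_tree (bouquet (hs x))).
Proof.
move=> ehs; pose m x := (tree_size (list_tree wt (hs x))).+1.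
apply: (computable_foldl (encS := edges_tree) (F := fun=> add_loop)
  (st := fun=> [::]) (computable_nil e) ehs
  (B := fun x => (m x * (m x * (10 * m x))).+1)).
- have st := foldl_ctx_state e edges_tree wt.
  have item := foldl_ctx_item e edges_tree wt.
  have path := computable_add_path st item.
  apply: computable_merge (computable_pair1 path) _ (computable_pair2 path).
  exact: computable_nil.
- by rewrite /m; have := computable_size ehs; auto 20 with polyb.
move=> x k; have := list_tree_take_size wt (hs x) k.
rewrite /m; set M := tree_size (list_tree wt (hs x)) => leM.
have : size (take k (hs x)) <= M.+1.
  by have := size_le_list_tree wt (take k (hs x)); lia.
have : {in take k (hs x), forall h, tree_size (wt h) <= M}.
  by move=> h /(mem_list_tree_size wt) leh; apply: leq_trans leh leM.
move: (take k (hs x)) => hs'; clear => leM lehs.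
set K := M.+1 * (10 * M.+1).
suff: forall E, tree_size (edges_tree (foldl add_loop E hs')) <=
      tree_size (edges_tree E) + size hs' * K.
  move/(_ [::])/leq_trans; apply.
  rewrite (_ : tree_size (edges_tree [::]) = 1) // add1n ltnS.
  by rewrite leq_mul2r lehs orbT.
elim: hs' leM {lehs} => [|h hs' IH] leM E; first by rewrite /=; lia.
have leh := leM h (mem_head _ _).
apply: leq_trans (IH _ _) _; first by move=> g gl; rewrite leM // inE gl orbT.
rewrite (_ : size (h :: hs') = (size hs').+1) // mulSn addnA leq_add2r.
apply: leq_trans (merge_nil_size _ _) _.
have [_ s2] := foldl_path_step_size [::] E h; apply: leq_trans s2 _.
rewrite leq_add2l /K leq_mul //.
  have := size_le_list_tree (@letter_tree A) h.
  by rewrite -/(word_tree h) -/(wt h); lia.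
by rewrite leq_mul2l /= add1n.
Qed.

Definition fold_state_tree :=
  pair_tree (pair_tree (@word_tree A) (@word_tree A))
            (pair_tree edges_tree edges_tree).

Lemma computable_fold_step X (e : X -> tree) (s : X -> fold_state) :
  computable e (fun x => fold_state_tree (s x)) ->
  computable e (fun x => fold_state_tree (fold_step (s x))).
Proof.
move=> es; have es1 := computable_pair1 es; have es2 := computable_pair2 es.
have seen := computable_pair1 es2; have todo := computable_pair2 es2.
pose step2 (x : X) d (todo : seq edge) v : fold_state :=
  (redirect d.2 v (s x).1.1, redirect d.2 v (s x).1.2,
       ([::], merge d.2 v (catrev (s x).2.1 todo))).
apply: (eq_computable (f := fun x => if (s x).2.2 is d :: r then
   if lookup d.1 (s x).2.1 is v :: _ then fold_state_tree (step2 x d r v)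
   else fold_state_tree ((s x).1, (d :: (s x).2.1, r))
   else fold_state_tree (s x))).
  move=> x; rewrite /fold_step; case: (s x).2.2 => //= d r.
  by case: (lookup _ _).
apply: (computable_case (F := fun x d r =>
   if lookup d.1 (s x).2.1 is v :: _ then fold_state_tree (step2 x d r v)
   else fold_state_tree ((s x).1, (d :: (s x).2.1, r))) todo es).
have d' := case_ctx_head e edge_tree; have r' := case_ctx_tail e edge_tree.
have seen' := case_ctx_env edge_tree seen.
pose e' := case_ctx e edge_tree.
apply: (computable_case (e := e') (enc := wt)
  (l := fun z => lookup z.2.1.1 (s z.1).2.1)
  (F := fun z v _ => fold_state_tree (step2 z.1 z.2.1 z.2.2 v))).
- exact: computable_lookup key_tree_inj (computable_pair1 d') seen'.
- apply: computable_pair; first exact: case_ctx_env es1.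
  by apply: computable_pair => //; apply: computable_cons_list.
have v'' := case_ctx_head e' wt.
have q'' := case_ctx_env wt (computable_pair2 d').
have es1'' := case_ctx_env wt (case_ctx_env edge_tree es1).
have seen'' := case_ctx_env wt seen'.
have r'' := case_ctx_env wt r'.
apply: computable_pair; apply: computable_pair.
- exact: computable_redirect q'' v'' (computable_pair1 es1'').
- exact: computable_redirect q'' v'' (computable_pair2 es1'').
- exact: computable_nil.
exact: computable_merge q'' v'' (computable_catrev seen'' r'').
Qed.

Definition edge_le m d :=
  [&& tree_size (wt d.1.1) <= m, tree_size (letter_tree d.1.2) <= m
    & tree_size (wt d.2) <= m].

(** Name sizes and the number of edges are bounded separately. Renaming may replace short names by
    long ones, so the total size can grow; but it only copies existing names and never adds edges,
    so both separate bounds persist. *)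
Definition fold_state_le m n (s : fold_state) :=
  [&& tree_size (wt s.1.1) <= m, tree_size (wt s.1.2) <= m,
      all (edge_le m) s.2.1, all (edge_le m) s.2.2 &
      size s.2.1 + size s.2.2 <= n].

Lemma redirect_le u v m x :
  tree_size (wt v) <= m -> tree_size (wt x) <= m ->
  tree_size (wt (redirect u v x)) <= m.
Proof. by rewrite /redirect; case: ifP. Qed.

Lemma fold_step_le m n s :
  fold_state_le m n s -> fold_state_le m n (fold_step s).
Proof.
case: s => [[b t] [seen [|d todo]]] //= /and5P[/= leb let_ seen_le].
move=> /andP[d_le todo_le] len; rewrite /fold_step /=.
case look: (lookup _ _) => [|v r].
  by rewrite /fold_state_le /= leb let_ d_le seen_le todo_le /=; lia.
have vm : tree_size (wt v) <= m.
  have : v \in lookup d.1 seen by rewrite look mem_head.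
  by rewrite mem_lookup => /(allP seen_le)/and3P[].
rewrite /fold_state_le /= !redirect_le //= size_map catrevE size_cat size_rev.
apply/andP; split; last by lia.
rewrite all_map all_cat all_rev; apply/andP; split.
  apply: sub_all seen_le => d' /and3P[l1 l2 l3].
  by rewrite /edge_le /= l2 !redirect_le.
apply: sub_all todo_le => d' /and3P[l1 l2 l3].
by rewrite /edge_le /= l2 !redirect_le.
Qed.

Lemma edges_tree_le m E :
  all (edge_le m) E -> tree_size (edges_tree E) <= (size E * (3 * m).+3).+1.
Proof.
move=> Em; apply: list_tree_size_le => -[[p a] q] /(allP Em)/and3P[].
by rewrite /edge_tree /pair_tree /wt /=; lia.
Qed.

Lemma fold_state_tree_le m n s :
  fold_state_le m n s ->
  tree_size (fold_state_tree s) <= 2 * m + n * (3 * m).+3 + 5.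
Proof.
case: s => [[b t] [seen todo]] /and5P[/= leb let_ /edges_tree_le].
set K := (3 * m).+3 => les /edges_tree_le; rewrite -/K => let' len.
have : size seen * K + size todo * K <= n * K.
  by rewrite -mulnDl leq_mul2r len orbT.
by move: leb let_ les let'; rewrite /wt /=; lia.
Qed.

Lemma fold_state_leP s :
  fold_state_le (tree_size (fold_state_tree s))
                (tree_size (fold_state_tree s)) s.
Proof.
have le_E E : all (edge_le (tree_size (edges_tree E))) E.
  apply/allP => -[[p a] q] /(mem_list_tree_size edge_tree).
  rewrite -/edges_tree; move: (tree_size (edges_tree E)) => k.
  rewrite /edge_tree /edge_le /wt /= => lek; apply/and3P.
  by split; lia.
have le_mono E k : tree_size (edges_tree E) <= k -> all (edge_le k) E.
  move=> lek; apply: sub_all (le_E E) => d /and3P[l1 l2 l3].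
  by rewrite /edge_le !(leq_trans _ lek).
case: s => [[b t] [seen todo]]; set m := tree_size _; rewrite /fold_state_le /=.
have := @size_le_list_tree edge edge_tree seen.
have := @size_le_list_tree edge edge_tree todo.
have : m = (tree_size (wt b) + tree_size (wt t) + tree_size (edges_tree seen) +
  tree_size (edges_tree todo)).+3 by rewrite /m /wt /=; lia.
rewrite -!/(edges_tree _) => em sz1 sz2.
by apply/and5P; split; try apply: le_mono; lia.
Qed.

Lemma iter_fold_step_size s k :
  tree_size (fold_state_tree (iter k fold_step s)) <=
  2 * tree_size (fold_state_tree s) +
    tree_size (fold_state_tree s) * (3 * tree_size (fold_state_tree s)).+3 + 5.
Proof.
apply: fold_state_tree_le; elim: k => [|k IH]; first exact: fold_state_leP.
exact: fold_step_le.
Qed.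

Lemma computable_fold_graph X (e : X -> tree) (s : X -> fold_state) :
  computable e (fun x => fold_state_tree (s x)) ->
  computable e (fun x => fold_state_tree (fold_graph (s x))).
Proof.
move=> es; have es2 := computable_pair2 es; have todo := computable_pair2 es2.
pose m x := tree_size (fold_state_tree (s x)).
(* A quadratic number of steps is run as two nested loops, both with the initial list of edges as
   counter. *)
apply: (eq_computable (f := fun x => fold_state_tree
  (iter (size (s x).2.2) (iter (size (s x).2.2) fold_step) (s x)))).
  by move=> x; rewrite -iterM.
apply: (computable_iter (f := fun x => iter (size (s x).2.2) fold_step) es todo
  (B := fun x => 2 * m x + m x * (3 * m x).+3 + 5)).
- set e' := fun z => Cons _ _.
  have st : computable e' (fun z => fold_state_tree z.2).
    exact: computable_snd (computable_id e').
  have todo' : computable e' (fun z => edges_tree (s z.1).2.2).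
    apply: computable_trans (computable_comp fst todo).
    exact: computable_fst (computable_id e').
  pose m' (z : X * fold_state) := tree_size (fold_state_tree z.2).
  apply: (computable_iter (f := fun _ => fold_step) st todo'
    (B := fun x => 2 * m' x + m' x * (3 * m' x).+3 + 5)).
  + apply: computable_fold_step.
    exact: (computable_snd (computable_id (fun z => Cons (e' z.1) _))).
  + by rewrite /m'; have := computable_size st; auto 20 with polyb.
  by move=> z k _; apply: iter_fold_step_size.
- by rewrite /m; have := computable_size es; auto 20 with polyb.
by move=> x k _; rewrite -iterM; apply: iter_fold_step_size.
Qed.

Definition label_tree := pair_tree (@word_tree A) (@word_tree A).

Lemma lookup_size (K : eqType) (T : Type) (k : K) (l : seq (K * T)) :
  size (lookup k l) <= size l.
Proof.
rewrite /lookup -[leqRHS]addn0 -[0]/(size (@nil T)).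
elim: l [::] => //= d l IH r.
apply: leq_trans (IH _) _; case: ifP => _ /=; lia.
Qed.

(** Two bounds, because they evolve differently: after a round the vertices are sources of edges of
    the graph, whereas the walks gain a letter each time. *)
Definition labels_le M m (L : seq (word A * word A)) :=
  all (fun x => (tree_size (wt x.1) <= M) && (tree_size (wt x.2) <= m)) L.

Lemma labels_tree_le M m L :
  labels_le M m L ->
  tree_size (list_tree label_tree L) <= (size L * (M + m).+2).+1.
Proof.
move=> Lm; apply: list_tree_size_le => -[u w] /(allP Lm)/andP[].
by rewrite /label_tree /wt /=; lia.
Qed.

Lemma extend_le m E L :
  let M := tree_size (edges_tree E) in
  forall M', labels_le M' m L ->
  labels_le M (m + M).+1 (extend E L) /\ size (extend E L) <= size E.
Proof.
move=> M M' Lm.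
suff gen E' L' : {subset E' <= E} -> labels_le M (m + M).+1 L' ->
  labels_le M (m + M).+1 (foldl (extend_step L) L' E') /\
  size (foldl (extend_step L) L' E') <= size E' + size L'.
  by have [//|//|le1] := gen E [::]; rewrite addn0.
elim: E' L' => //= d E' IH L' sub lL'.
have subE' : {subset E' <= E} by move=> x xE; apply: sub; rewrite inE xE orbT.
rewrite {2 4}/extend_step; case look: lookup => [|w r].
  by have [] := IH L' subE' lL'; split=> //; lia.
have [|? /= ?] := IH ((d.1.1, d.1.2 :: w) :: L') subE'; last by split=> //; lia.
rewrite /= lL' andbT.
have : (d.2, w) \in L by rewrite -mem_lookup look mem_head.
move=> /(allP Lm)/andP[_ /=].
have := mem_list_tree_size edge_tree (sub d (mem_head _ _)).
rewrite -/(edges_tree E) -/M; case: d {look sub} => [[p a] q].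
by rewrite /edge_tree /wt /=; lia.
Qed.

Lemma computable_extend X (e : X -> tree) (E : X -> seq edge)
    (L : X -> seq (word A * word A)) :
  computable e (fun x => edges_tree (E x)) ->
  computable e (fun x => list_tree label_tree (L x)) ->
  computable e (fun x => list_tree label_tree (extend (E x) (L x))).
Proof.
move=> eE eL.
pose M x := tree_size (edges_tree (E x)).
pose m x := tree_size (list_tree label_tree (L x)).
apply: (computable_foldl (encS := list_tree label_tree) (st := fun=> [::])
  (F := fun x => extend_step (L x)) (computable_nil e) eE
  (B := fun x => (M x * (M x + (m x + M x).+1).+2).+1)).
- pose e' := foldl_ctx e (list_tree label_tree) edge_tree.
  have item := foldl_ctx_item e (list_tree label_tree) edge_tree.
  have st := foldl_ctx_state e (list_tree label_tree) edge_tree.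
  have L' := foldl_ctx_env (list_tree label_tree) edge_tree eL.
  apply: (eq_computable (e := e') (f := fun z =>
    if lookup z.2.2 (L z.1.1) is w :: _
    then list_tree label_tree ((z.2.1.1, z.2.1.2 :: w) :: z.1.2)
    else list_tree label_tree z.1.2)).
    by move=> z; rewrite /extend_step; case: (lookup _ _).
  apply: (computable_case (l := fun z => lookup z.2.2 (L z.1.1)) (enc := wt)
    (F := fun z w _ =>
       list_tree label_tree ((z.2.1.1, z.2.1.2 :: w) :: z.1.2))).
  + exact: computable_lookup word_tree_inj (computable_pair2 item) L'.
  + exact: st.
  have key' := case_ctx_env wt (computable_pair1 item).
  apply: computable_cons_list; last exact: case_ctx_env st.
  apply: computable_pair; first exact: computable_pair1 key'.
  apply: computable_cons_list; first exact: computable_pair2 key'.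
  exact: case_ctx_head e' wt.
- rewrite /M /m; have := computable_size eL; have := computable_size eE.
  by auto 20 with polyb.
move=> x k.
have Lm : labels_le (m x) (m x) (L x).
  apply/allP => -[u w] /(mem_list_tree_size label_tree).
  by rewrite -/(m x) /label_tree /wt /=; lia.
have sub : tree_size (edges_tree (take k (E x))) <= M x.
  exact: list_tree_take_size.
have [le1 le2] := extend_le (take k (E x)) Lm.
apply: leq_trans (labels_tree_le le1) _; rewrite ltnS leq_mul //.
  exact: leq_trans le2 (ltnW (leq_trans (size_le_list_tree edge_tree _) sub)).
by rewrite !ltnS leq_add // ltnS leq_add2l.
Qed.

Definition search_tree :=
  pair_tree (list_tree label_tree) (list_tree (@word_tree A)).

Lemma computable_search_step X (e : X -> tree) (E : X -> seq edge)
    (v : X -> word A) s :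
  computable e (fun x => edges_tree (E x)) ->
  computable e (fun x => wt (v x)) ->
  computable e (fun x => search_tree (s x)) ->
  computable e (fun x => search_tree (search_step (E x) (v x) (s x))).
Proof.
move=> eE ev es.
have L := computable_extend eE (computable_pair1 es).
apply: (computable_pair L).
apply: (eq_computable (f := fun x => if (s x).2 is w :: r
  then list_tree wt (w :: r)
  else list_tree wt (lookup (v x) (extend (E x) (s x).1)))).
  by move=> x /=; case: (s x).2.
apply: (computable_case (F := fun x w r => list_tree wt (w :: r))).
- exact: computable_pair2 es.
- exact: computable_lookup word_tree_inj ev L.
exact: computable_cons_list (case_ctx_head e wt) (case_ctx_tail e wt).
Qed.

(* After k steps every label carries a walk of length k. *)
Lemma iter_search_step_le E u v k :
  let M := tree_size (edges_tree E) in
  let s := iter k (search_step E v) ([:: (u, [::])], lookup v [:: (u, [::])]) in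
  [/\ labels_le (tree_size (wt u) + M) (k * M.+1).+1 s.1,
      size s.1 <= M.+1, size s.2 <= M.+1 &
      all (fun w => tree_size (wt w) <= (k * M.+1).+1) s.2].
Proof.
move=> M; elim: k => [|k] /=.
  by rewrite /lookup /=; case: ifP; split=> //=; rewrite leq_addr.
set s := iter _ _ _ => -[le1 le2 le3 le4].
have [le5 le6] := extend_le E le1.
have sizeE : size E < M := size_le_list_tree edge_tree E.
have le5' : labels_le (tree_size (wt u) + M) (k.+1 * M.+1).+1 (extend E s.1).
  apply: sub_all le5 => -[a w] /andP[/= l1 l2]; rewrite -/M in l1 l2.
  by rewrite (leq_trans l1) ?leq_addl // (leq_trans l2) // mulSn; lia.
have le7 : size (extend E s.1) <= M.+1 by lia.
split=> //=; case s2: s.2 le3 le4 => [|w r] //= le3.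
- by move=> _; apply: leq_trans (lookup_size _ _) le7.
- move=> _; apply/allP => w; rewrite mem_lookup => /(allP le5').
  by case/andP.
case/andP=> l1 /allP l2; apply/andP; split.
  by rewrite (leq_trans l1) ?mulSn; lia.
by apply/allP => x /l2 l; rewrite (leq_trans l) ?mulSn; lia.
Qed.

Lemma computable_search X (e : X -> tree) (E : X -> seq edge)
    (u v g : X -> word A) :
  computable e (fun x => edges_tree (E x)) ->
  computable e (fun x => wt (u x)) -> computable e (fun x => wt (v x)) ->
  computable e (fun x => wt (g x)) ->
  computable e (fun x => search_tree (search (E x) (u x) (v x) (g x))).
Proof.
move=> eE eu ev eg.
have L0 : computable e (fun x => list_tree label_tree [:: (u x, [::])]).
  apply: computable_cons_list; last exact: computable_nil.
  by apply: computable_pair => //; apply: computable_nil.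
pose M x := tree_size (edges_tree (E x)).
pose m x := (tree_size (wt (g x)) * (M x).+1).+1.
pose N x := tree_size (wt (u x)) + M x.
apply: (computable_iter (encS := search_tree)
  (f := fun x => search_step (E x) (v x))
  (st := fun x => ([:: (u x, [::])], lookup (v x) [:: (u x, [::])])) _ eg
  (B := fun x => (((M x).+1 * (N x + m x).+2).+1 +
                  ((M x).+1 * (m x).+1).+1).+1)).
- exact: computable_pair L0 (computable_lookup word_tree_inj ev L0).
- set e' := fun z => Cons _ _.
  have env f : computable e f -> computable e' (fun z => f z.1).
    move=> ef; apply: computable_trans (computable_comp fst ef).
    exact: computable_fst (computable_id e').
  apply: computable_search_step (env _ eE) (env _ ev) _.
  exact: computable_snd (computable_id e').
- rewrite /M /m /N; have := computable_size eE; have := computable_size eu.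
  by have := computable_size eg; auto 20 with polyb.
move=> x k lek; have [] := iter_search_step_le (E x) (u x) (v x) k.
set s := iter _ _ _; rewrite -/(M x) -/(N x) => le1 le2 le3 le4.
have lem : (k * (M x).+1).+1 <= m x.
  rewrite ltnS leq_mul2r /=; apply: leq_trans lek _.
  exact: ltnW (size_le_list_tree (@letter_tree A) _).
rewrite /= ltnS leq_add //.
  apply: leq_trans (labels_tree_le le1) _.
  by rewrite ltnS leq_mul // !ltnS leq_add2l.
apply: leq_trans (list_tree_size_le (M := m x) _) _.
  by move=> w /(allP le4) lew; apply: leq_trans lew lem.
by rewrite ltnS leq_mul.
Qed.

Lemma computable_closest :
  computable (@instance_tree A) (fun i => wt (closest i)).
Proof.
set e := @instance_tree A.
have hs : computable e (fun i => list_tree wt i.1).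
  exact: computable_fst (computable_id e).
have g : computable e (fun i => wt i.2).
  exact: computable_snd (computable_id e).
have p := computable_add_path (computable_bouquet hs) g.
have base : computable e (fun=> wt [::]) := computable_nil e.
have none : computable e (fun=> edges_tree [::]) := computable_nil e.
have s := computable_pair (computable_pair base (computable_pair1 p))
                          (computable_pair none (computable_pair2 p)).
have s' := computable_fold_graph s.
have s'1 := computable_pair1 s'; have s'2 := computable_pair2 s'.
apply: (computable_cat g (computable_head _)).
have r := computable_search (computable_pair1 s'2)
  (computable_pair1 s'1) (computable_pair2 s'1) g.
exact: computable_pair2 r.
Qed.

End Algorithm.

(** * Free reduction *)

Section FreeReduction.

Variable A : finType.
Implicit Types (a b : letter A) (u v w : word A).

Lemma linvK : involutive (@linv A).
Proof. by case=> x b; rewrite /linv negbK. Qed.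

Definition winv w : word A := rev (map (@linv A) w).

Lemma winvK : involutive winv.
Proof.
move=> w; rewrite /winv map_rev revK -map_comp map_id_in // => a _.
exact: linvK.
Qed.

Lemma size_winv w : size (winv w) = size w.
Proof. by rewrite size_rev size_map. Qed.

(** The action of a letter on reduced words by left multiplication, as in van der Waerden's
    construction of the free group. *)
Definition push a w : word A :=
  if w is b :: w' then if b == linv a then w' else a :: w else [:: a].

Definition nf w : word A := foldr push [::] w.

Fixpoint reduced w : bool :=
  if w is a :: w' then
    (if w' is b :: _ then b != linv a else true) && reduced w'
  else true.

Lemma reduced_push a w : reduced w -> reduced (push a w).
Proof.
case: w => //= b w /andP[bw redw]; case: ifP => // ba.
by rewrite /= ba bw.
Qed.

Lemma reduced_foldr_push u w : reduced w -> reduced (foldr push w u).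
Proof. by elim: u => //= a u IH /IH; apply: reduced_push. Qed.

Lemma reduced_nf w : reduced (nf w).
Proof. exact: reduced_foldr_push. Qed.

Lemma push_linvK a w : reduced w -> push a (push (linv a) w) = w.
Proof.
case: w => [|b w] /=; first by rewrite eqxx.
rewrite linvK; case: eqP => [-> | _] /=; last by rewrite eqxx.
by case: w => //= c w /andP[/negPf ->].
Qed.

Lemma nf_id w : reduced w -> nf w = w.
Proof.
elim: w => //= a w IH /andP[aw /IH]; rewrite /nf /= => ->.
by case: w aw {IH} => //= b w /negPf ->.
Qed.

(** If [push] cancels, the pair removed acts trivially on reduced words by [push_linvK]. This gives
    [nf_catl], and through it associativity. *)
Lemma foldr_push_push a u w :
  reduced w -> foldr push w (push a u) = push a (foldr push w u).
Proof.
move=> redw; case: u => //= b u; case: eqP => // ->.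
by rewrite push_linvK //; apply: reduced_foldr_push.
Qed.

Lemma nf_catl u v : nf (nf u ++ v) = nf (u ++ v).
Proof.
rewrite /nf !foldr_cat -!/(nf _); elim: u => //= a u <-.
by rewrite foldr_push_push // reduced_nf.
Qed.

Lemma nf_catr u v : nf (u ++ nf v) = nf (u ++ v).
Proof. by rewrite /nf !foldr_cat -!/(nf _) (nf_id (reduced_nf v)). Qed.

Lemma nf_winvl w : nf (winv w ++ w) = [::].
Proof.
elim: w => // a w IH; rewrite /winv /= rev_cons cat_rcons.
rewrite -/(winv w) -IH /nf !foldr_cat /= -!/(nf _) -{2}[a]linvK.
by rewrite push_linvK ?reduced_nf.
Qed.

Lemma size_push a w : size (push a w) <= (size w).+1.
Proof. by case: w => //= b w; case: ifP => //= _; lia. Qed.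

Lemma size_nf w : size (nf w) <= size w.
Proof. by elim: w => //= a w IH; apply: leq_trans (size_push _ _) _. Qed.

(** A concrete model of the free group, to which the universal property of [F] is applied. *)
Definition free_group : Type := {w : word A | reduced w}.

HB.instance Definition _ := Choice.on free_group.

Lemma free_group_eq (x y : free_group) : sval x = sval y -> x = y.
Proof. exact: val_inj. Qed.

Definition free_group_class w : free_group := Sub (nf w) (reduced_nf w).

Definition free_group_mul (x y : free_group) : free_group :=
  free_group_class (val x ++ val y).

Definition free_group_one : free_group := free_group_class [::].

Definition free_group_inv (x : free_group) : free_group :=
  free_group_class (winv (val x)).

Lemma free_group_mulA : associative free_group_mul.
Proof.
move=> x y z; apply: val_inj.
by rewrite /= nf_catl nf_catr catA.
Qed.

Lemma free_group_mul1 : left_id free_group_one free_group_mul.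
Proof. by move=> [w redw]; apply: val_inj; apply: nf_id. Qed.

Lemma free_group_mulg1 : right_id free_group_one free_group_mul.
Proof. by move=> [w redw]; apply: val_inj; rewrite /= cats0 nf_id. Qed.

Lemma free_group_mulV :
  left_inverse free_group_one free_group_inv free_group_mul.
Proof. by move=> x; apply: val_inj; rewrite /= nf_catl nf_winvl. Qed.

Lemma free_group_mulgV :
  right_inverse free_group_one free_group_inv free_group_mul.
Proof.
move=> [w redw]; apply: val_inj.
by rewrite /= nf_catr -{1}[w]winvK nf_winvl.
Qed.

HB.instance Definition _ := isGroup.Build free_group
  free_group_mulA free_group_mul1 free_group_mulg1
  free_group_mulV free_group_mulgV.

End FreeReduction.

(** * Evaluation of words in a group *)

Section Values.

Local Open Scope group_scope.

Variables (A : finType) (F : groupType) (iota : A -> F).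
Implicit Types (a : letter A) (u v w : word A).

Let value := word_val iota.

Lemma letter_val_linv a : letter_val iota (linv a) = (letter_val iota a)^-1.
Proof. by case: a => x [] /=; rewrite /letter_val /= ?invgK. Qed.

Lemma word_val_nil : value [::] = 1.
Proof. exact: big_nil. Qed.

Lemma word_val_cons a w : value (a :: w) = letter_val iota a * value w.
Proof. exact: big_cons. Qed.

Lemma word_val_cat u v : value (u ++ v) = value u * value v.
Proof. exact: big_cat. Qed.

Lemma word_val_winv w : value (winv w) = (value w)^-1.
Proof.
elim: w => [|a w IH]; first by rewrite word_val_nil invg1.
rewrite /winv /= rev_cons -cats1 word_val_cat -/(winv w) IH.
by rewrite !word_val_cons word_val_nil mulg1 letter_val_linv invgM.
Qed.

(** The universal property gives a morphism from [F] to the group of reduced words that sends each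
    basis element to its one-letter word. It sends the value of [w] to the class of [w], so the
    value determines the normal form. *)
Lemma word_val_inj_nf u v :
  free_basis iota -> value u = value v -> nf u = nf v.
Proof.
move=> basis uv.
have [[phi phiM phi_iota] _] :=
  basis (free_group A) (fun x => free_group_class [:: (x, false)]).
have phi1 : phi 1 = 1.
  by apply: (mulgI (phi 1)); rewrite -phiM !mulg1.
have phiV x : phi x^-1 = (phi x)^-1.
  by apply: (mulgI (phi x)); rewrite -phiM !mulgV.
have phi_letter a : phi (letter_val iota a) = free_group_class [:: a].
  case: a => x []; rewrite /letter_val /= ?phiV ?phi_iota //.
have phi_val w : phi (value w) = free_group_class w.
  elim: w => [|a w IH]; first by rewrite word_val_nil phi1.
  rewrite word_val_cons phiM IH phi_letter; apply: free_group_eq.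
  by rewrite /= -/(nf _) (nf_id (reduced_nf w)).
by have := phi_val u; rewrite uv phi_val => /(congr1 sval).
Qed.

End Values.

(** * Walks, folding and search *)

Section Walks.

Variable A : finType.
Implicit Types (a : letter A) (p q r u v w g h x : word A) (d : edge A).
Implicit Types (E : seq (edge A)).

Fixpoint walk E p w q : Prop :=
  if w is a :: w' then exists2 r, (p, a, r) \in E & walk E r w' q else p = q.

Lemma walk_cat E p u r v q :
  walk E p u r -> walk E r v q -> walk E p (u ++ v) q.
Proof.
elim: u p => [|a u IH] p /=; first by move=> ->.
by case=> s pas sur rvq; exists s => //; apply: IH.
Qed.

Lemma walk_sub E E' p w q : {subset E <= E'} -> walk E p w q -> walk E' p w q.
Proof.
move=> sub; elim: w p => //= a w IH p [r /sub par rwq].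
by exists r => //; apply: IH.
Qed.

Lemma walk_merge u v E p w q :
  walk E p w q -> walk (merge u v E) (redirect u v p) w (redirect u v q).
Proof.
elim: w p => [|a w IH] p /=; first by move=> ->.
case=> r par /IH rwq; exists (redirect u v r) => //.
by apply/mapP; exists (p, a, r).
Qed.

Definition inverse_closed E :=
  forall p a q, (p, a, q) \in E -> (q, linv a, p) \in E.

Lemma walk_winv E p w q :
  inverse_closed E -> walk E p w q -> walk E q (winv w) p.
Proof.
move=> invE; elim: w p => [|a w IH] p /=; first by move=> ->.
case=> r par /IH; rewrite /winv /= rev_cons -cats1 => /walk_cat; apply.
by exists p => //; apply: invE.
Qed.

Lemma inverse_closed_merge u v E :
  inverse_closed E -> inverse_closed (merge u v E).
Proof.
move=> invE p a q /mapP[[[p' a'] q'] /invE inE [-> -> ->]].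
by apply/mapP; exists (q', linv a', p').
Qed.

Definition deterministic E := {in E &, forall d d', d.1 = d'.1 -> d = d'}.

(** If a walk reads [a] and then [linv a], the second edge has the same source and label as the
    reverse of the first. By determinism it is that reverse and leads back to the start, so the pair
    can be cut out. *)
Lemma walk_nf E p w q :
  inverse_closed E -> deterministic E -> walk E p w q -> walk E p (nf w) q.
Proof.
move=> invE detE; elim: w p => //= a w IH p [r par /IH].
case: (nf w) => [|b w'] /=; first by exists r.
case: eqP => [-> [s ras sw'q] | _]; last by exists r.
have /(_ erefl)[->] := detE _ _ (invE _ _ _ par) ras.
by [].
Qed.

Lemma add_path_walk u E h :
  let s := foldl (@path_step A) (u, E) h in
  [/\ s.1 = catrev h u, {subset E <= s.2} & walk s.2 u h s.1].
Proof.
elim: h u E => [|a h IH] u E /=; first by split.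
have [-> sub wa] := IH (a :: u) ((u, a, a :: u) :: (a :: u, linv a, u) :: E).
split=> //.
  by move=> d dE; apply: sub; rewrite !inE dE !orbT.
by exists (a :: u) => //; apply: sub; rewrite mem_head.
Qed.

Lemma add_path_inverse_closed u E h :
  inverse_closed E -> inverse_closed (foldl (@path_step A) (u, E) h).2.
Proof.
elim: h u E => [|a h IH] u E invE //=; apply: IH => p b q.
rewrite !inE => /or3P[/eqP[-> -> ->] | /eqP[-> -> ->] | /invE ->].
- by rewrite eqxx orbT.
- by rewrite linvK eqxx.
by rewrite !orbT.
Qed.

Lemma redirect_nil u : redirect u [::] [::] = [::].
Proof. by rewrite /redirect; case: ifP. Qed.

(** A loop at the base persists when further loops are added, since paths only add edges and the
    renamings fix the base. *)
Lemma bouquet_walk hs h : h \in hs -> walk (bouquet hs) [::] h [::].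
Proof.
have loop_walk E g w : walk E [::] w [::] -> walk (add_loop E g) [::] w [::].
  move=> wE; have [_ sub _] := add_path_walk [::] E g.
  have := walk_merge (add_path E g).1 [::] (walk_sub sub wE).
  by rewrite redirect_nil.
have loops_walk hs' E w :
    walk E [::] w [::] -> walk (foldl (@add_loop A) E hs') [::] w [::].
  by elim: hs' E => //= g hs' IH E wE; apply: IH; apply: loop_walk.
rewrite /bouquet; elim: hs [::] => //= g hs IH E.
rewrite inE => /predU1P[->|/IH //]; apply: loops_walk.
have [_ _ walk_g] := add_path_walk [::] E g.
have := walk_merge (add_path E g).1 [::] walk_g.
by rewrite redirect_nil /redirect eqxx.
Qed.

Lemma bouquet_inverse_closed hs : inverse_closed (bouquet hs).
Proof.
rewrite /bouquet; have: inverse_closed [::] by [].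
elim: hs [::] => //= g hs IH E invE; apply: IH.
by apply: inverse_closed_merge; apply: add_path_inverse_closed.
Qed.

Lemma mem_extend_step L L' d y :
  (y \in extend_step L L' d) =
  (if lookup d.2 L is w :: _ then y == (d.1.1, d.1.2 :: w) else false) ||
  (y \in L').
Proof. by rewrite /extend_step; case: lookup => // w r; rewrite inE. Qed.

Lemma mem_extend E L p w :
  (p, w) \in extend E L ->
  exists a r w', [/\ w = a :: w', (p, a, r) \in E & (r, w') \in L].
Proof.
suff gen L' : (p, w) \in foldl (extend_step L) L' E ->
    (p, w) \in L' \/
    exists a r w', [/\ w = a :: w', (p, a, r) \in E & (r, w') \in L].
  by move/gen=> [].
elim: E L' => [|[[p' a'] q'] E IH] L' /=; first by left.
case/IH => [|[a [r [w' [-> par rw']]]]]; last first.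
  by right; exists a, r, w'; rewrite inE par orbT.
rewrite mem_extend_step /= => /orP[|]; last by left.
case look: lookup => [|w' s] // /eqP[-> ->]; right; exists a', q', w'.
by rewrite mem_head -mem_lookup look mem_head.
Qed.

Lemma extend_mem E L p a r w' :
  (p, a, r) \in E -> (r, w') \in L -> exists w, (p, w) \in extend E L.
Proof.
move=> parE rw'.
suff gen L' : (exists w, (p, w) \in L') \/ (p, a, r) \in E ->
    exists w, (p, w) \in foldl (extend_step L) L' E by apply: gen; right.
elim: E {parE} L' => [|d E IH] L' /=; first by case.
move=> H; apply: IH; case: H => [[w pw]|].
  by left; exists w; rewrite mem_extend_step pw orbT.
rewrite inE => /predU1P[<- | parE]; [left | by right].
have: w' \in lookup r L by rewrite mem_lookup.
rewrite /extend_step /=; case: lookup => // w s _.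
by exists (a :: w); rewrite mem_head.
Qed.

(** Rounds treat lengths in increasing order, so the first round that labels [v] yields a shortest
    walk. *)
Lemma search_correct E u v g k :
  let s := iter k (search_step E v) ([:: (u, [::])], lookup v [:: (u, [::])]) in
  if s.2 is w :: _ then
    walk E v w u /\ forall w', walk E v w' u -> size w <= size w'
  else forall w', walk E v w' u -> k < size w'.
Proof.
set s0 := (_, _).
(* The vertices labelled in round [k'] are exactly those with a walk of length [k'] to [u]. One
   witness is enough, since the possible extensions depend only on the vertex. *)
have layer p k' :
    (forall w, (p, w) \in (iter k' (search_step E v) s0).1 ->
       walk E p w u /\ size w = k') /\
    (forall w, walk E p w u -> size w = k' ->
       exists w', (p, w') \in (iter k' (search_step E v) s0).1).
  elim: k' p => [|k' IH] p /=.
    split=> [w|[|//] -> _]; first by rewrite inE => /eqP[-> ->].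
    by exists [::]; rewrite inE.
  split=> [w /mem_extend[a [r [w' [-> par rw']]]] | [|a w] //=].
    have [/(_ _ rw')[walk_w' sz] _] := IH r.
    by split; [exists r | rewrite /= sz].
  case=> r par rwu [sz]; have [_ /(_ _ rwu sz)[w' rw']] := IH r.
  exact: extend_mem par rw'.
elim: k => [|k] /=.
  by rewrite /lookup /=; case: eqP => [-> | neq] //= [|a w] //= /esym.
have [layer1 layer2] := layer v k.+1.
case: (iter k _ _).2 => [|w r] //= noshort.
case look: lookup => [|w r].
  move=> w' walk_w'; rewrite ltn_neqAle noshort // andbT.
  apply/eqP => /esym sz; have [w] := layer2 w' walk_w' sz.
  by rewrite -mem_lookup /= look.
have /layer1[walk_w sz] : (v, w) \in (iter k.+1 (search_step E v) s0).1.
  by rewrite -mem_lookup /= look mem_head.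
by split=> // w' /noshort; rewrite sz.
Qed.

Lemma search_shortest E u v g w :
  walk E v w u -> size w <= size g ->
  let r := head [::] (search E u v g).2 in
  walk E v r u /\ forall w', walk E v w' u -> size r <= size w'.
Proof.
move=> walk_w sz; have := search_correct E u v g (size g).
rewrite -/(search E u v g) /=; case: (search _ _ _ _).2 => //=.
by move/(_ w walk_w); rewrite ltnNge sz.
Qed.

(* An identification removes an edge and restarts the scan. *)
Definition fold_potential (s : fold_state A) : nat :=
  (size s.2.1 + size s.2.2) * (size s.2.1 + size s.2.2).-1 + size s.2.2.

Lemma fold_potential_step s :
  s.2.2 <> [::] -> fold_potential (fold_step s) < fold_potential s.
Proof.
case: s => [bt [seen [|d todo]]] // _; rewrite /fold_step /=.
case: lookup => [|v r]; rewrite /fold_potential /=.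
  by rewrite addSn !addnS ltnSn.
rewrite /merge size_map catrevE size_cat size_rev !addnS add0n /=.
move: (size seen) (size todo) => m n.
by case: (m + n) => [|k] /=; rewrite ?mulSn ?mulnS; lia.
Qed.

(** With all [n] edges unscanned the potential is [n * n.-1 + n], that is [n * n], the number of
    iterations in [fold_graph]. It drops until nothing is left to scan. *)
Lemma fold_graph_done b u E : (fold_graph (b, u, ([::], E))).2.2 = [::].
Proof.
rewrite /fold_graph; set s0 := (b, u, ([::], E)).
have : fold_potential s0 <= size E * size E.
  by rewrite /fold_potential /=; case: (size E) => //= n; nia.
rewrite -[size s0.2.2]/(size E); move: (size E * size E) s0 => n.
elim: n => [|n IH] s pot.
  by case s22: s.2.2 pot => [|d l] /=; rewrite /fold_potential s22 //= addnS.
have [s22|s22] := eqVneq s.2.2 [::].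
  by elim: n.+1 => //= k {}IH; rewrite /fold_step IH.
by rewrite iterSr; apply: IH; have := fold_potential_step (elimN eqP s22); lia.
Qed.

End Walks.

(** * Correctness *)

Section Correctness.

Local Open Scope group_scope.

Variables (F : groupType) (A : finType) (iota : A -> F) (hs : seq (word A)).
Implicit Types (a : letter A) (p q r u v w g h x : word A) (d : edge A).
Implicit Types (E : seq (edge A)) (s : fold_state A).

Let value := word_val iota.
Let H := subgroup_of_words iota hs.

Definition coset_repr u : F := value (rev u).

Definition same_coset u v : Prop := H (coset_repr u * (coset_repr v)^-1).

(** This says [H p a = H q]: the edges are edges of the Schreier graph of [H] on right cosets. *)
Definition coset_edges E : Prop :=
  forall p a q, (p, a, q) \in E ->
    H (coset_repr p * letter_val iota a * (coset_repr q)^-1).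

Lemma same_coset_refl u : same_coset u u.
Proof. by rewrite /same_coset mulgV; apply: gen_one. Qed.

Lemma same_coset_redirect u v x :
  same_coset u v -> same_coset x (redirect u v x).
Proof.
by rewrite /redirect; case: eqP => [->|_] // _; apply: same_coset_refl.
Qed.

Lemma coset_repr_cons a u :
  coset_repr (a :: u) = coset_repr u * letter_val iota a.
Proof.
rewrite /coset_repr rev_cons -cats1 /value word_val_cat word_val_cons.
by rewrite word_val_nil mulg1.
Qed.

Lemma walk_coset E p w q :
  coset_edges E -> walk E p w q ->
  H (coset_repr p * value w * (coset_repr q)^-1).
Proof.
move=> cE; elim: w p => [|a w IH] p /=.
  by move=> ->; rewrite /value word_val_nil mulg1; apply: same_coset_refl.
case=> r /cE par /IH rwq; have := gen_mul par rwq.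
by rewrite /value word_val_cons !mulgA mulgVK.
Qed.

Lemma coset_edges_merge u v E :
  same_coset u v -> coset_edges E -> coset_edges (merge u v E).
Proof.
move=> uv cE p a q /mapP[[[p' a'] q'] /= /cE pq [-> -> ->]].
have := gen_mul (gen_mul (gen_inv (same_coset_redirect p' uv)) pq)
  (same_coset_redirect q' uv).
by rewrite invgM invgK !mulgA !mulgVK.
Qed.

Lemma coset_edges_add_path u E h :
  coset_edges E -> coset_edges (foldl (@path_step A) (u, E) h).2.
Proof.
elim: h u E => [|a h IH] u E cE //=; apply: IH => p b q.
rewrite !inE => /or3P[/eqP[-> -> ->] | /eqP[-> -> ->] | /cE //].
  by rewrite coset_repr_cons mulgV; apply: gen_one.
rewrite coset_repr_cons letter_val_linv mulgK.
exact: same_coset_refl.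
Qed.

Lemma coset_edges_bouquet : coset_edges (bouquet hs).
Proof.
have : {subset hs <= hs} by [].
rewrite /bouquet; have: coset_edges [::] by [].
elim: {1 3}hs [::] => //= h hs' IH E cE sub; apply: IH; last first.
  by move=> g gin; apply: sub; rewrite inE gin orbT.
apply: coset_edges_merge; last exact: coset_edges_add_path.
have [-> _ _] := add_path_walk [::] E h.
rewrite /same_coset /coset_repr catrevE cats0 revK /value word_val_nil.
rewrite invg1 mulg1.
by apply: gen_mem; exists h => //; apply: sub; rewrite mem_head.
Qed.

(** Loops at [b] can be concatenated and reversed, so their values form a subgroup; it contains the
    generators. *)
Lemma loop_label E b y :
  inverse_closed E -> (forall h, h \in hs -> walk E b h b) -> H y ->
  exists2 w, value w = y & walk E b w b.
Proof.
move=> invE loops.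
elim=> {y} [|y [h hin ->]|y z _ [u <- bu] _ [v <- bv]|y _ [u <- bu]].
- by exists [::] => //; apply: word_val_nil.
- by exists h => //; apply: loops.
- by exists (u ++ v); [apply: word_val_cat | apply: walk_cat bv].
by exists (winv u); [apply: word_val_winv | apply: walk_winv].
Qed.

Definition all_edges s := s.2.1 ++ s.2.2.

(** The base is tracked in the state because folding may rename it; what persists is that its name
    represents the coset [H] and the name of the target the coset [H g]. *)
Record fold_invariant g s : Prop := FoldInvariant {
  inv_closed : inverse_closed (all_edges s);
  inv_cosets : coset_edges (all_edges s);
  inv_det : deterministic s.2.1;
  inv_source : H (coset_repr s.1.1);
  inv_target : H (coset_repr s.1.2 * (value g)^-1);
  inv_loops : forall h, h \in hs -> walk (all_edges s) s.1.1 h s.1.1;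
  inv_path : walk (all_edges s) s.1.1 g s.1.2 }.

Lemma fold_invariant_init g :
  let s := add_path (bouquet hs) g in
  fold_invariant g ([::], s.1, ([::], s.2)).
Proof.
have [target sub path] := add_path_walk [::] (bouquet hs) g.
split=> //=.
- by apply: add_path_inverse_closed; apply: bouquet_inverse_closed.
- by apply: coset_edges_add_path; apply: coset_edges_bouquet.
- by rewrite /coset_repr /value word_val_nil; apply: gen_one.
- rewrite target /coset_repr catrevE cats0 revK mulgV; exact: gen_one.
by move=> h hin; apply: walk_sub sub _; apply: bouquet_walk.
Qed.

Lemma fold_invariant_step g s :
  fold_invariant g s -> fold_invariant g (fold_step s).
Proof.
case: s => [[b t] [seen [|[[p a] q] todo]]] //=.
case=> invE cE det src tgt loops path.
rewrite /fold_step /=; rewrite /all_edges /= in invE cE det src tgt loops path.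
case look: lookup => [|v r].
  have eqE : (p, a, q) :: seen ++ todo =i seen ++ (p, a, q) :: todo.
    by move=> d; rewrite !(inE, mem_cat) orbCA.
  have subE : {subset seen ++ (p, a, q) :: todo <= (p, a, q) :: seen ++ todo}.
    by move=> d; rewrite eqE.
  split=> //=; rewrite /all_edges /=.
  - by move=> x c y; rewrite !eqE; apply: invE.
  - by move=> x c y; rewrite eqE; apply: cE.
  - move=> d d'; rewrite !inE.
    have nokey d'' : d'' \in seen -> d''.1 <> (p, a).
      case: d'' => k z kz /= kpa.
      by have := mem_lookup (p, a) seen z; rewrite look -kpa kz.
    move=> /predU1P[->|dS] /predU1P[->|d'S] //= e.
    + by case: (nokey _ d'S).
    + by case: (nokey _ dS).
    exact: det.
  - by move=> h /loops; apply: walk_sub.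
  exact: walk_sub subE path.
have pav : (p, a, v) \in seen by rewrite -mem_lookup look mem_head.
set E := seen ++ _ in invE cE loops path.
(* Both [q] and [v] are reached from [p] by [a], so both represent the coset [H p a]. *)
have qv : same_coset q v.
  have paq : (p, a, q) \in E by rewrite mem_cat mem_head orbT.
  have pavE : (p, a, v) \in E by rewrite mem_cat pav.
  have := gen_mul (gen_inv (cE _ _ _ paq)) (cE _ _ _ pavE).
  by rewrite /same_coset !invgM invgK !mulgA mulgVK mulgVK.
(* Dropping the clashing edge loses nothing: after the renaming it coincides with the image of
   [(p, a, v)]. *)
have eqE : merge q v E =i merge q v (catrev seen todo).
  move=> d; apply/mapP/mapP => -[d' d'E ->].
    move: d'E; rewrite mem_cat inE => /or3P[d'E|/eqP->|d'E].
    - by exists d' => //; rewrite catrevE mem_cat mem_rev d'E.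
    - exists (p, a, v); first by rewrite catrevE mem_cat mem_rev pav.
      by rewrite /redirect /= eqxx; case: (v == q).
    by exists d' => //; rewrite catrevE mem_cat d'E orbT.
  exists d' => //; move: d'E; rewrite catrevE !mem_cat mem_rev inE.
  by case: (_ \in _) => //= ->; rewrite orbT.
have subE : {subset merge q v E <= merge q v (catrev seen todo)}.
  by move=> d; rewrite eqE.
(* Determinism is immediate here, since the scanned part is reset to [[::]]. *)
split=> //=; rewrite /all_edges /=.
- by move=> x c y; rewrite -!eqE; apply: inverse_closed_merge.
- by move=> x c y; rewrite -eqE; apply: coset_edges_merge.
- have := gen_mul (gen_inv (same_coset_redirect b qv)) src.
  by rewrite invgM invgK mulgVK.
- have := gen_mul (gen_inv (same_coset_redirect t qv)) tgt.
  by rewrite invgM invgK !mulgA mulgVK.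
- by move=> h /loops /(walk_merge q v); apply: walk_sub.
exact: walk_sub subE (walk_merge q v path).
Qed.

Lemma closest_correct g :
  free_basis iota -> closest_element_spec iota (hs, g) (closest (hs, g)).
Proof.
move=> basis; rewrite /closest /=; set s0 := (_, _, _).
have: fold_invariant g (fold_graph s0).
  rewrite /fold_graph; elim: (_ * _)%N => [|n IH] /=.
    exact: fold_invariant_init.
  exact: fold_invariant_step.
have := @fold_graph_done A [::] (add_path (bouquet hs) g).1
                            (add_path (bouquet hs) g).2.
rewrite -/s0; case: (fold_graph s0) => [[b t] [E todo]] /= ->.
case; rewrite /all_edges /= cats0 => invE cE det src tgt loops path.
(* The inverse of [g] is a walk from the target to the base, so the search succeeds within [size g]
   rounds. *)
have back := walk_winv invE path.
have [walk_w shortest] := search_shortest back (eq_leq (size_winv g)).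
set w := head _ _ in walk_w shortest *.
have Hgw : H (value (g ++ w)).
  have := gen_mul (gen_mul (gen_inv tgt) (walk_coset cE walk_w)) src.
  by rewrite /value word_val_cat !invgM invgK !mulgA !mulgVK.
(* Write [y] as the label [x] of a loop. The walk [winv g ++ x] can be freely reduced in the folded
   graph, and its normal form is that of [u], both words having the value [g^-1 y]. *)
have minw (y : F) u : H y -> value u = (value g)^-1 * y -> size w <= size u.
  move=> /(loop_label invE loops)[x <- bxb] ux.
  have := shortest _ (walk_nf invE det (walk_cat back bxb)).
  suff -> : nf (winv g ++ x) = nf u by move/leq_trans; apply; apply: size_nf.
  apply: (word_val_inj_nf basis).
  by rewrite word_val_cat word_val_winv -/(value g) -/(value x) -ux.
have dist_w : (value g)^-1 * value (g ++ w) = value w.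
  by rewrite /value word_val_cat mulKg.
(* [minw] serves twice: for the element [g w] itself it shows that [w] is a geodesic word, and for
   any other [h'] that it is no closer. *)
split=> //; exists (size w).
  split; first by exists w.
  by move=> u; apply: (minw _ u Hgw).
move=> h' n' Hh' [[u uh <-] _]; exact: minw Hh' uh.
Qed.

End Correctness.

(** * From the length of the input words to the size of their encoding, and conclusion *)

Lemma instance_tree_size (A : finType) :
  poly_bound (@instance_size A) (fun i => tree_size (instance_tree i)).
Proof.
(* The basis is fixed, so even a unary rank costs a constant: [2 * #|A| + 1] for the rank, [3] for
   the sign and one node joining them. *)
pose K := (2 * #|A| + 6).
have letter_le (a : letter A) : tree_size (letter_tree a) <= K.
  have nat_le n : tree_size (nat_tree n) <= (2 * n).+1 by elim: n => //= n; lia.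
  have le_rank : tree_size (nat_tree (enum_rank a.1)) <= (2 * #|A|).+1.
    by apply: leq_trans (nat_le _) _; rewrite ltnS leq_mul2l /= ltnW.
  have le_sign : tree_size (nat_tree a.2) <= 3 by case: a.2.
  apply: leq_trans (leq_add le_rank le_sign : _.+1 <= _.+1) _.
  by rewrite /K; lia.
have word_le (w : word A) : tree_size (word_tree w) <= (size w * K.+1).+1.
  by apply: list_tree_size_le => a _; apply: letter_le.
apply: (poly_bound_le (g := fun i => (instance_size i * K.+3).+3)); last first.
  apply: poly_boundS; apply: poly_boundS; apply: poly_boundS.
  by apply: poly_boundM; [apply: poly_bound_id | apply: poly_bound_const].
move=> [hs g]; rewrite /instance_size /instance_tree /= mulnDl.
have := word_le g; suff : tree_size (list_tree (@word_tree A) hs) <=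
  ((\sum_(h <- hs) (size h).+1) * K.+3).+1 by lia.
elim: hs => [|h hs IH] /=; first by [].
by rewrite big_cons mulnDl; have := word_le h; lia.
Qed.

Theorem theorem3p1 (F : groupType) (A : finType) (iota : A -> F)
    (basis : free_basis iota) :
  poly_time_solvable (@instance_tree A) (@word_tree A) (@instance_size A)
    (closest_element_spec iota).
Proof.
have [c [N [b bP runP]]] := computable_closest A.
have [p pP] := poly_bound_trans (instance_tree_size A) bP.
exists c, p => i.
have [n [s [ex le_n [s0 _]]]] := runP i (init (instance_tree i)) erefl.
exists (closest i), n, s; split=> //; first exact: leq_trans le_n (pP i).
by case: i {ex le_n s0} => hs g; apply: closest_correct.
Qed.
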